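(* Let $\nu\in\mathbb{R}$ be fixed and, for each integer $N\ge3$, let $\mu^\nu=\mu^\nu(N)$ be the best constant of the embedding $H^1(\mathbb{R}^N)\hookrightarrow L^2\bigl(\mathbb{R}^N,(\nu^2+|x|^2)^{-1}\,dx\bigr)$. Then $$\lim_{N\to\infty}\frac{\mu^\nu}{\frac{N^2(N-2)}{4(N+1)}}=1.$$
   Context: The best constant is $$\mu^\nu=\inf_{u\in H^1(\mathbb{R}^N)\setminus\{0\}}\frac{\int_{\mathbb{R}^N}\left(|\nabla u|^2+|u|^2\right)dx}{\int_{\mathbb{R}^N}\frac{|u(x)|^2}{\nu^2+|x|^2}\,dx}.$$ *)

(* Defs.v *)
From HB Require Import structures.
From mathcomp Require Import all_boot all_order all_algebra.
From mathcomp Require Import all_classical all_reals all_analysis.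
Import Order.TTheory GRing.Theory Num.Theory.
Import numFieldNormedType.Exports.

Set Implicit Arguments.
Unset Strict Implicit.
Unset Printing Implicit Defensive.

Local Open Scope classical_set_scope.
Local Open Scope ring_scope.

(* R^n is 'rV[R]_n, with the sigma-algebra generated by the coordinates (as
   the library does for tuples); it coincides with the Borel sigma-algebra.
   Every class of a.e. equal Lebesgue measurable functions has a
   representative that is measurable for it. *)
Definition measure_rV_display : measure_display -> measure_display.
Proof. exact. Qed.

Section measurable_rV.
Context {d} {T : measurableType d} (n : nat).

Let coors : 'I_n -> 'rV[T]_n -> T := fun i x => x ord0 i.

Let rV_set0 : g_sigma_preimage coors set0.
Proof. exact: sigma_algebra0. Qed.

Let rV_setC A : g_sigma_preimage coors A -> g_sigma_preimage coors (~` A).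
Proof. exact: sigma_algebraC. Qed.

Let rV_bigcup (F : _^nat) : (forall i, g_sigma_preimage coors (F i)) ->
  g_sigma_preimage coors (\bigcup_i (F i)).
Proof. exact: sigma_algebra_bigcup. Qed.

HB.instance Definition _ := @isMeasurable.Build (measure_rV_display d)
  'rV[T]_n (g_sigma_preimage coors) rV_set0 rV_setC rV_bigcup.

End measurable_rV.

Lemma measurable_coord d (T : measurableType d) n (i : 'I_n) :
  measurable_fun [set: 'rV[T]_n] (fun x => x ord0 i).
Proof.
move=> _ Y mY; rewrite setTI; apply: sub_sigma_algebra => /=.
rewrite -bigcup_seq/=; exists i => /=; first by rewrite mem_index_enum.
by exists Y => //; rewrite setTI.
Qed.

Lemma measurable_fun_coord d1 d2 (T1 : measurableType d1)
    (T2 : measurableType d2) n (f : T1 -> 'rV[T2]_n) :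
  (forall i, measurable_fun [set: T1] (fun x => f x ord0 i)) ->
  measurable_fun [set: T1] f.
Proof.
move=> mf.
apply: (measurability
  (\big[setU/set0]_(i < n) preimage_set_system [set: 'rV[T2]_n]
     (fun x : 'rV[T2]_n => x ord0 i) measurable)) => //.
move=> A [B]; rewrite -bigcup_seq => -[i _ [Y mY <-]] <-.
by rewrite [X in _ `&` X]setTI; exact: mf.
Qed.

(* Concatenation (x, v) |-> x :: v, from R x R^n to R^n.+1. *)
Definition rV_cons (R : realType) n (p : R * 'rV[R]_n) : 'rV[R]_n.+1 :=
  row_mx (p.1%:M : 'rV[R]_1) p.2.

Lemma measurable_rV_cons (R : realType) n :
  measurable_fun [set: (R * 'rV[R]_n)%type] (@rV_cons R n).
Proof.
apply: measurable_fun_coord => i.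
have [j ->|j ->] := @split_ordP 1 n i.
  rewrite (_ : (fun _ => _) = fst) //.
  by apply/funext => p /=; rewrite /rV_cons [LHS](@row_mxEl R 1 1 n) mxE (ord1 j).
rewrite (_ : (fun _ => _) = (fun v : 'rV[R]_n => v ord0 j) \o snd).
  by apply: measurableT_comp => //; exact: measurable_coord.
by apply/funext => p /=; rewrite /rV_cons [LHS](@row_mxEr R 1 1 n).
Qed.

Section lebesgue_succ.
Context (R : realType) (n : nat).
Variable mu : {sigma_finite_measure set 'rV[R]_n -> \bar R}.

Definition lebesgue_succ : set 'rV[R]_n.+1 -> \bar R :=
  pushforward (@lebesgue_measure R \x mu)%E (@rV_cons R n).

Let lebesgue_succ0 : lebesgue_succ set0 = 0%E.
Proof. by rewrite /lebesgue_succ /pushforward preimage_set0 measure0. Qed.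

Let lebesgue_succ_ge0 A : (0 <= lebesgue_succ A)%E.
Proof. by rewrite /lebesgue_succ /pushforward measure_ge0. Qed.

Let lebesgue_succ_sigma_additive : semi_sigma_additive lebesgue_succ.
Proof.
move=> F mF tF mUF; rewrite /lebesgue_succ /pushforward preimage_bigcup.
apply: measure_semi_sigma_additive.
- by move=> k; rewrite -[X in measurable X]setTI; exact: measurable_rV_cons.
- apply/trivIsetP => /= i j _ _ ij; rewrite -preimage_setI.
  by move/trivIsetP : tF => /(_ _ _ _ _ ij) ->//; rewrite preimage_set0.
- rewrite -preimage_bigcup -[X in measurable X]setTI.
  exact: measurable_rV_cons.
Qed.

HB.instance Definition _ := isMeasure.Build _ _ _ lebesgue_succ
  lebesgue_succ0 lebesgue_succ_ge0 lebesgue_succ_sigma_additive.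

Let rV_uncons (v : 'rV[R]_n.+1) : R * 'rV[R]_n :=
  (v ord0 ord0, \row_j v ord0 (lift ord0 j)).

Let rV_consK : cancel (@rV_cons R n) rV_uncons.
Proof.
move=> [x v]; rewrite /rV_uncons /rV_cons; congr pair.
  rewrite (_ : ord0 = lshift n (@ord0 0)); last exact: val_inj.
  by rewrite [LHS](@row_mxEl R 1 1 n) mxE eqxx.
apply/rowP => j; rewrite mxE (_ : lift ord0 j = @rshift 1 n j).
  by rewrite [LHS](@row_mxEr R 1 1 n).
exact: val_inj.
Qed.

Let measurable_rV_uncons : measurable_fun setT rV_uncons.
Proof.
apply/measurable_fun_pairP; split => /=; first exact: measurable_coord.
apply: measurable_fun_coord => i.
rewrite (_ : (fun _ => _) = fun v : 'rV[R]_n.+1 => v ord0 (lift ord0 i)).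
  exact: measurable_coord.
by apply/funext => v; rewrite mxE.
Qed.

Let lebesgue_succ_sigma_finite : sigma_finite setT lebesgue_succ.
Proof.
have /sigma_finiteP[F [TF ndF Foo]] := sigma_finiteT (@lebesgue_measure R).
have /sigma_finiteP[G [TG ndG Goo]] := sigma_finiteT mu.
exists (fun k => rV_uncons @^-1` (F k `*` G k)).
  rewrite -preimage_bigcup; apply/esym/seteqP; split=> // v _.
  have [i _ Fi] : (\bigcup_i F i) (rV_uncons v).1 by rewrite -TF.
  have [j _ Gj] : (\bigcup_i G i) (rV_uncons v).2 by rewrite -TG.
  exists (maxn i j) => //; split.
    by move: Fi; exact/subsetPset/ndF/leq_maxl.
  by move: Gj; exact/subsetPset/ndG/leq_maxr.
move=> k; have [mF Fk] := Foo k; have [mG Gk] := Goo k; split.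
  rewrite -[X in measurable X]setTI; apply: measurable_rV_uncons => //.
  exact: measurableX.
rewrite /lebesgue_succ /pushforward -comp_preimage.
rewrite (_ : rV_uncons \o _ = id); last by apply/funext => p; exact: rV_consK.
by rewrite preimage_id product_measure1E// lte_mul_pinfty// ge0_fin_numE.
Qed.

HB.instance Definition _ := Measure_isSigmaFinite.Build _ _ _ lebesgue_succ
  lebesgue_succ_sigma_finite.

End lebesgue_succ.

(* Lebesgue measure on R^n: the n-fold product of the Lebesgue measure on R. *)
Fixpoint lebesgueN (R : realType) (n : nat) :
    {sigma_finite_measure set 'rV[R]_n -> \bar R} :=
  if n is m.+1 then lebesgue_succ (lebesgueN R m)
  else \d_(0 : 'rV[R]_0).

Section sobolev.
Context (R : realType) (n : nat).
Local Notation V := 'rV[R]_n.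
Local Notation leb := (lebesgueN R n).

Definition partial (i : 'I_n) (f : V -> R) : V -> R :=
  fun x => 'D_(delta_mx ord0 i) f x.

Definition smooth (f : V -> R) := forall s : seq 'I_n,
  let g := foldr partial f s in
  continuous g /\ forall i x, derivable g x (delta_mx ord0 i).

Definition test_function (f : V -> R) :=
  smooth f /\ compact (closure [set x | f x != 0]).

(* g is the weak gradient of u, and belongs to L^2. *)
Definition L2_weak_gradient (u : V -> R) (g : 'I_n -> V -> R) := forall i,
  g i \in Lfun leb 2%:E /\
  forall phi, test_function phi ->
    (\int[leb]_x (u x * partial i phi x)%:E =
     - \int[leb]_x (g i x * phi x)%:E)%E.

Definition sobolevH1 (u : V -> R) :=
  u \in Lfun leb 2%:E /\ exists g, L2_weak_gradient u g.

(* Squared Euclidean norm (the norm `|x| of 'rV[R]_n is the sup norm). *)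
Definition sqnorm (x : V) : R := \sum_(i < n) x ord0 i ^+ 2.

Definition H1_energy (u : V -> R) (g : 'I_n -> V -> R) : \bar R :=
  (\int[leb]_x ((\sum_(i < n) g i x ^+ 2) + u x ^+ 2)%:E)%E.

Definition weighted_L2 (nu : R) (u : V -> R) : \bar R :=
  (\int[leb]_x (u x ^+ 2 / (nu ^+ 2 + sqnorm x))%:E)%E.

(* The weak gradient is unique up to a.e. equality, so the quotient depends
   only on u. *)
Definition best_constant (nu : R) : \bar R :=
  ereal_inf [set q | exists u g, [/\ sobolevH1 u, ~ u = \0 %[ae leb],
    L2_weak_gradient u g & q = (H1_energy u g / weighted_L2 nu u)%E]].

End sobolev.

(* Main.v *)
Require Import Defs.
From mathcomp Require Import all_boot all_order all_algebra.
(* Imported before all_analysis, which otherwise makes another normed module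
   structure on R canonical, not the one used in the statements of derive. *)
From mathcomp Require Import normedtype.
Import numFieldNormedType.Exports.
From mathcomp Require Import all_classical all_reals all_analysis.
From mathcomp Require Import measurable_realfun ring lra.
Import Order.TTheory GRing.Theory Num.Theory.

Set Implicit Arguments.
Unset Strict Implicit.
Unset Printing Implicit Defensive.

Local Open Scope classical_set_scope.
Local Open Scope ring_scope.

(* The constant is squeezed between (N - 2)^2 / 4 and (2 N + 1) (nu^2 + N / 8),
   both equivalent to N^2 / 4.

   Lower bound: Hardy's inequality. For the field F = x / (a + |x|^2), with
   a > 0, one has div F >= (N - 2) / (a + |x|^2) >= (N - 2) |F|^2, and
   integrating u^2 div F = - 2 u grad u . F with Young's inequality gives
   (N - 2)^2 / 4 int u^2 / (a + |x|^2) <= int |grad u|^2; Fatou's lemma lets a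
   decrease to nu^2. The product rule for u^2 with a weak gradient avoids
   mollifiers: testing against translates of a test function and using the
   density of test functions in L^2, the translates of u satisfy
   |u(. + h e_i) - u|_2 <= h |g_i|_2, and their difference quotients converge
   weakly to g_i. This suffices to differentiate, at t = 0,
   int u(x)^2 F(x - t e_i) dx = int u(x + t e_i)^2 F(x) dx.

   Upper bound: take u = exp(- 2 |x|^2), for which int |grad u|^2 = 2 N int u^2
   and, by Jensen's inequality,
   int u^2 / (nu^2 + |x|^2) >= int u^2 / (nu^2 + N / 8). *)

(** * Lebesgue measure on row vectors *)

(** A weak gradient is known only through integrals against test functions, whereas Hardy's field
    has unbounded support and cannot be tested against. Hence everything passes through
    translations, under which Lebesgue integrals are exactly invariant; the field then enters only
    through bounds on itself and its partial derivatives, uniform because a > 0.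

    The constants of the upper bound: for u = exp(- b |x|^2) one has int |grad u|^2 = b N int u^2,
    and the mean of |x|^2 under the density proportional to u^2 is N / (4 b). The resulting bound (b
    N + 1) (nu^2 + N / (4 b)) has leading term N^2 / 4 for every fixed b; the proof takes b = 2.
    Jensen's inequality loses nothing at this order, since in high dimension |x|^2 concentrates
    around its mean.

    The case nu = 0 is included. The weight is then singular at the origin, where its formal value
    is 0: the weighted integral is finite by Hardy's inequality itself, and pointwise estimates have
    to avoid the origin. *)

Lemma lebesgue_measure_shift (R : realType) (t : R) (A : set R) :
  measurable A ->
  lebesgue_measure ((fun x => x + t) @^-1` A) = lebesgue_measure A.
Proof.
move=> mA.
have mt : measurable_fun setT (fun x : measurableTypeR R => x + t : measurableTypeR R).
  exact: measurable_funD.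
transitivity (pushforward lebesgue_measure
  (fun x : measurableTypeR R => x + t : measurableTypeR R) A); first by [].
apply/esym/lebesgue_measure_unique => //= _ [[a b]] _ <-.
rewrite /pushforward.
rewrite (_ : _ @^-1` _ = `]a - t, b - t]%classic).
  rewrite !lebesgue_measure_itv/= !lte_fin ltrD2r.
  by case: ifPn => // _; rewrite -!EFinD opprB addrA subrK.
by apply/seteqP; split => x /=; rewrite !in_itv/= ltrBlDr lerBrDr.
Qed.

Section lebesgueN.
Context (R : realType).

Lemma rV_cons0 n (p : R * 'rV[R]_n) : rV_cons p ord0 ord0 = p.1.
Proof.
rewrite (_ : ord0 = lshift n (@ord0 0)); last exact: val_inj.
by rewrite /rV_cons [LHS](@row_mxEl R 1 1 n) mxE eqxx.
Qed.

Lemma rV_consS n (p : R * 'rV[R]_n) j :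
  rV_cons p ord0 (lift ord0 j) = p.2 ord0 j.
Proof.
rewrite (_ : lift ord0 j = @rshift 1 n j); last exact: val_inj.
by rewrite /rV_cons [LHS](@row_mxEr R 1 1 n).
Qed.

Lemma lebesgueN_succE n (A : set 'rV[R]_n.+1) : lebesgueN R n.+1 A =
  (\int[lebesgue_measure]_t lebesgueN R n [set y | A (rV_cons (t, y))])%E.
Proof.
rewrite /= /lebesgue_succ /pushforward /product_measure1.
apply: eq_integral => t _ /=; congr (lebesgueN R n _).
by apply/seteqP; split => y; rewrite /xsection/= inE.
Qed.

Lemma measurable_lebesgueN_slice n (A : set 'rV[R]_n.+1) : measurable A ->
  measurable_fun setT (fun t : R => lebesgueN R n [set y | A (rV_cons (t, y))]).
Proof.
move=> mA; have mB : measurable (@rV_cons R n @^-1` A).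
  by rewrite -[X in measurable X]setTI; exact: measurable_rV_cons.
have := measurable_fun_xsection (lebesgueN R n) mB.
apply: eq_measurable_fun => t _ /=; congr (lebesgueN R n _).
by apply/seteqP; split => y; rewrite /xsection/= inE.
Qed.

Lemma measurable_rV_shift n (v : 'rV[R]_n) :
  measurable_fun [set: 'rV[R]_n] (fun x => x + v).
Proof.
apply: measurable_fun_coord => i; under eq_fun do rewrite mxE.
by apply: measurable_funD => //; exact: measurable_coord.
Qed.

Lemma integral_shift1 (f : R -> \bar R) (t : R) :
  measurable_fun setT f -> (forall x, 0 <= f x)%E ->
  (\int[lebesgue_measure]_x f (x + t)%R = \int[lebesgue_measure]_x f x)%E.
Proof.
move=> mf f0.
pose phi := fun x : measurableTypeR R => x + t : measurableTypeR R.
have mphi : measurable_fun setT phi by exact: measurable_funD.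
rewrite -[LHS](ge0_integral_pushforward mphi lebesgue_measure measurableT mf)//.
by apply: eq_measure_integral => //= A mA AS; exact: lebesgue_measure_shift.
Qed.

(** Slicing along the first coordinate: its shift is absorbed by the outer one-dimensional integral,
    the shift of the others by induction in each slice. *)
Lemma lebesgueN_shift n (v : 'rV[R]_n) (A : set 'rV[R]_n) : measurable A ->
  lebesgueN R n ((fun x => x + v) @^-1` A) = lebesgueN R n A.
Proof.
elim: n v A => [|n IHn] v A mA.
  rewrite (_ : _ @^-1` _ = A)//; apply/funext => x /=.
  by rewrite (_ : x + v = x)//; apply/rowP => -[].
rewrite !lebesgueN_succE.
pose w : 'rV[R]_n := \row_j v ord0 (lift ord0 j).
rewrite -(integral_shift1 (v ord0 ord0) (measurable_lebesgueN_slice mA))//.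
apply: eq_integral => t _ /=.
rewrite -[RHS](IHn w); last first.
  have mc : measurable_fun setT (fun y : 'rV[R]_n => rV_cons (t + v ord0 ord0, y)).
    exact: (measurableT_comp (@measurable_rV_cons R n) (pair1_measurable _)).
  by have := mc measurableT _ mA; rewrite setTI.
congr (lebesgueN R n _); apply/funext => y /=; congr (A _).
apply/rowP => i; rewrite mxE.
by case: (unliftP ord0 i) => [j|] ->; rewrite ?rV_consS ?rV_cons0 ?mxE.
Qed.

Lemma integral_shift n (v : 'rV[R]_n) (f : 'rV[R]_n -> \bar R) :
  measurable_fun setT f ->
  (\int[lebesgueN R n]_x f (x + v)%R = \int[lebesgueN R n]_x f x)%E.
Proof.
move=> mf; rewrite integralE [RHS]integralE.
have ge0 (h : 'rV[R]_n -> \bar R) : measurable_fun setT h ->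
    (forall x, 0 <= h x)%E ->
    (\int[lebesgueN R n]_x h (x + v)%R = \int[lebesgueN R n]_x h x)%E.
  move=> mh h0.
  rewrite -[LHS](ge0_integral_pushforward (measurable_rV_shift v) (lebesgueN R n) measurableT mh)//.
  apply: eq_measure_integral => [|mv A mA _]; first exact: measurable_rV_shift.
  exact: lebesgueN_shift.
congr (_ - _)%E.
  rewrite -(ge0 _ (measurable_funepos mf) (funepos_ge0 f)).
  by apply: eq_integral => x _; rewrite !funeposE.
rewrite -(ge0 _ (measurable_funeneg mf) (funeneg_ge0 f)).
by apply: eq_integral => x _; rewrite !funenegE.
Qed.

Lemma integrable_shift n (v : 'rV[R]_n) (f : 'rV[R]_n -> \bar R) :
  (lebesgueN R n).-integrable setT f ->
  (lebesgueN R n).-integrable setT (fun x => f (x + v)).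
Proof.
move=> /integrableP[mf foo]; apply/integrableP; split.
  by apply: (measurableT_comp mf); exact: measurable_rV_shift.
rewrite (@integral_shift n v (fun x => `|f x|%E))//.
exact: measurableT_comp.
Qed.

Lemma measurable_rV_coord n (i : 'I_n) (A : set R) : measurable A ->
  measurable [set x : 'rV[R]_n | A (x ord0 i)].
Proof.
move=> mA; rewrite -[X in measurable X]setTI.
exact: (@measurable_coord _ _ _ i).
Qed.

Lemma lebesgueN_coord0 n :
  lebesgueN R n.+1 [set x : 'rV[R]_n.+1 | x ord0 ord0 = 0] = 0%E.
Proof.
rewrite lebesgueN_succE.
transitivity (\int[lebesgue_measure]_(t in [set: R]) (cst 0%E t : \bar R))%E.
  have m0 := measurable_rV_coord (@ord0 n) (measurable_set1 (0:R)).
  apply: ge0_ae_eq_integral => //; first exact: (measurable_lebesgueN_slice m0).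
  exists [set 0]; split => //; first exact: lebesgue_measure_set1.
  move=> t /=; apply: contra_notP => /eqP t0 _.
  rewrite (_ : [set y | _] = set0) ?measure0//.
  apply/seteqP; split => // y /=; rewrite rV_cons0/= => /eqP.
  by rewrite (negbTE t0).
by rewrite integral0.
Qed.

(** Needed to see that an everywhere positive function is not almost everywhere zero. *)
Lemma lebesgueN_setT_gt0 n : (0 < lebesgueN R n setT)%E.
Proof.
elim: n => [|n IHn]; first by rewrite /= diracT.
rewrite lebesgueN_succE (_ : (fun t : R => _) = cst (lebesgueN R n setT)).
  rewrite integral_cst// mule_gt0//.
  have : (0 < lebesgue_measure [set: R])%E.
    by have := @lebesgue_measure_itv R `]-oo, +oo[; rewrite set_itvNyy/= => ->; rewrite ltey.
  exact.
by apply/funext => t /=; congr (lebesgueN R n _).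
Qed.
End lebesgueN.

(** * Smooth functions *)

Section directional.
Context (R : realType) (n : nat).
Implicit Types (f : 'rV[R]_n -> R) (x v : 'rV[R]_n).

Lemma is_derive_lineP f x v d :
  is_derive x v f d <-> is_derive (0:R) 1 (fun t : R => f (t *: v + x)) d.
Proof.
have E : (fun h : R => h^-1 *: ((f \o shift x) (h *: v) - f x)) =
    (fun h : R => h^-1 *: (((fun t : R => f (t *: v + x)) \o shift 0) (h *: 1)
      - f (0 *: v + x))).
  by apply/funext => h /=; rewrite addr0 scaler1 scale0r add0r.
by split=> -[df dE]; apply: DeriveDef; rewrite /derivable/derive -?E// E.
Qed.

Lemma is_derive_line f x v (t d : R) :
  is_derive (t *: v + x) v f d -> is_derive t 1 (fun s : R => f (s *: v + x)) d.
Proof.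
have E : (fun h : R => h^-1 *: ((f \o shift (t *: v + x)) (h *: v)
      - f (t *: v + x))) =
    (fun h : R => h^-1 *: (((fun s : R => f (s *: v + x)) \o shift t) (h *: 1)
      - f (t *: v + x))).
  by apply/funext => h /=; rewrite scaler1 addrA -scalerDl.
by move=> [df dE]; apply: DeriveDef; rewrite /derivable/derive -?E.
Qed.

End directional.

(** * Flat exponentials on the line *)

Section flat_exponential.
Context (R : realType).

(** For [k = 0] this is the classical smooth function that is flat at the origin. The factor
    [t ^- k] makes the family stable under differentiation: the derivative combines the members of
    index [k.+1] and [k.+2]. *)
Definition flat_exp (s : R) (k : nat) (t : R) : R :=
  if 0 < t then t ^- k * expR (- s / t) else 0.

Lemma flat_exp_ge0 s k t : 0 <= flat_exp s k t.
Proof.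
rewrite /flat_exp; case: ifPn => // t0.
by rewrite mulr_ge0 ?expR_ge0// invr_ge0 exprn_ge0 ?ltW.
Qed.

(** The exponential dominates the term of degree [k.+1] of its series at [s / t]; this is one power
    of [t] more than [t ^- k] consumes, so a factor [t] survives and forces the limit 0 at the
    origin. *)
Lemma flat_exp_le s k t : 0 < s ->
  `|flat_exp s k t| <= k.+1`!%:R / s ^+ k.+1 * `|t|.
Proof.
move=> s0; rewrite ger0_norm ?flat_exp_ge0// /flat_exp; case: ifPn => [t0|_].
  rewrite gtr0_norm// mulNr expRN.
  have st : 0 <= s / t by rewrite divr_ge0// ltW.
  have /(le_trans _) := expR_ge1Dxn k st.
  move=> /(_ ((s / t) ^+ k.+1 / k.+1`!%:R)); rewrite lerDr ler01 => /(_ isT) H.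
  have f0 : 0 < k.+1`!%:R :> R by rewrite ltr0n fact_gt0.
  have a0 : 0 < (s / t) ^+ k.+1 / k.+1`!%:R by rewrite divr_gt0// exprn_gt0// divr_gt0.
  rewrite (@le_trans _ _ (t ^- k * ((s / t) ^+ k.+1 / k.+1`!%:R)^-1))//.
    apply: ler_wpM2l; first by rewrite invr_ge0 exprn_ge0// ltW.
    by rewrite lef_pV2 ?posrE ?expR_gt0.
  rewrite invf_div exprMn exprVn invfM invrK.
  rewrite [X in X <= _](_ : _ = k.+1`!%:R / s ^+ k.+1 * t)//.
  rewrite [t ^+ k.+1]exprS; field.
  by rewrite !expf_neq0 ?gt_eqF.
by rewrite mulr_ge0// divr_ge0// exprn_ge0// ltW.
Qed.

Lemma flat_exp_cvg0 s k : 0 < s -> flat_exp s k t @[t --> (0:R)] --> (0:R).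
Proof.
move=> s0; apply/cvgr0Pnorm_le => e e0.
pose C := k.+1`!%:R / s ^+ k.+1.
have C0 : 0 < C by rewrite divr_gt0 ?exprn_gt0// ltr0n fact_gt0.
near=> t; rewrite (le_trans (flat_exp_le _ _ s0))// -/C.
rewrite -ler_pdivlMl// mulrC.
near: t; exact: (@nbhs0_le R R^o _ (divr_gt0 e0 C0)).
Unshelve. all: by end_near. Qed.

Lemma is_derive_flat_exp s k (t : R) : 0 < s ->
  is_derive t 1 (flat_exp s k)
    (- k%:R * flat_exp s k.+1 t + s * flat_exp s k.+2 t).
Proof.
move=> s0; have [t0|t0|<-] := ltgtP 0 t.
- apply: (@near_eq_is_derive R R^o R^o (fun u => u ^- k * expR (- s / u))).
    near=> u; have u0 : 0 < u by near: u; exact: lt_nbhsr.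
    by rewrite /flat_exp u0.
  rewrite /flat_exp t0.
  have t0' := lt0r_neq0 t0.
  have dV : is_derive t 1 (fun u : R => - s / u) (s / t ^+ 2).
    have dI : is_derive t 1 (fun u : R => u^-1) (- t ^- 2 *: 1).
      exact: (@is_deriveV _ id).
    rewrite (_ : (fun u => - s / u) = - s \*: (fun u : R => u^-1))//.
    apply: is_derive_eq.
    by rewrite /GRing.scale/=; ring.
  have dE : is_derive t 1 (fun u => expR (- s / u)) (expR (- s / t) * (s / t ^+ 2)).
    exact: (@is_derive1_comp _ expR _ _ _ _ (is_derive_expR _) dV).
  have dP : is_derive t 1 (fun u : R => u ^- k) (- k%:R * t ^- k.+1).
    have dX : is_derive t 1 (fun u : R => u ^+ k) ((k%:R * t ^+ k.-1) *: 1).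
      rewrite (_ : (fun u => u ^+ k) = (@id R) ^+ k); last by rewrite exprfctE.
      exact: (@is_deriveX _ _ id).
    apply: is_derive_eq; first by apply: is_deriveV dX; rewrite expf_neq0.
    rewrite /GRing.scale/=; case: (k) => [|m]/=; first by rewrite !mul0r mulr0 oppr0 mul0r.
    by rewrite !exprS; field; rewrite expf_neq0//= t0'.
  rewrite (_ : (fun u => u ^- k * expR (- s / u)) =
    (fun u : R => u ^- k) * (fun u => expR (- s / u)))//.
  apply: is_derive_eq.
  rewrite /GRing.scale/= !exprS; field.
  by rewrite expf_neq0//= t0'.
- apply: (@near_eq_is_derive R R^o R^o (cst 0)).
    near=> u; have u0 : u < 0 by near: u; exact: lt_nbhsl.
    by rewrite /flat_exp ltNge ltW.
  by apply: is_derive_eq; rewrite /flat_exp ltNge (ltW t0)/= !mulr0 addr0.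
- rewrite {2 3}/flat_exp ltxx !mulr0 addr0.
  (* At the origin the difference quotient of the member of index [k] is exactly the member of index
     [k.+1], which tends to 0. *)
  have E : (fun h : R => h^-1 *: ((flat_exp s k \o shift 0) (h *: 1)
      - flat_exp s k 0)) = flat_exp s k.+1.
    apply/funext => h /=; rewrite addr0 scaler1 {2}/flat_exp ltxx subr0.
    rewrite /flat_exp; case: ifPn => [h0|_]; last by rewrite scaler0.
    by rewrite /GRing.scale/= mulrA exprS invfM.
  have H : flat_exp s k.+1 h @[h --> 0^'] --> (0:R).
    by apply: cvg_within_filter; exact: flat_exp_cvg0.
  apply: DeriveDef; rewrite /derivable/derive E; first by apply/cvg_ex; exists 0.
  exact/cvg_lim.
Unshelve. all: by end_near. Qed.

End flat_exponential.

(** * A syntax of smooth functions *)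

Section smooth_expressions.
Context (R : realType) (n : nat).

(* A class of smooth functions closed under partial derivatives and
   translations, whose compactly supported members are dense in L^2. *)
Inductive sexpr :=
| SCst of R
| SAdd of sexpr & sexpr
| SMul of sexpr & sexpr
| SFlat of nat & nat & R & R & 'I_n.

(** The rate [m.+1%:R^-1] is positive by construction, so every expression is smooth; a large [m]
    makes bumps close to indicators. The affine argument allows both orientations ([b] equal to 1 or
    -1, one for each face of a box), and translations act on [a] alone. *)
Fixpoint seval (e : sexpr) (x : 'rV[R]_n) : R :=
  match e with
  | SCst c => c
  | SAdd e1 e2 => seval e1 x + seval e2 x
  | SMul e1 e2 => seval e1 x * seval e2 x
  | SFlat m k b a i => flat_exp (m.+1%:R^-1) k (b * x ord0 i + a)
  end.

Fixpoint sderiv (j : 'I_n) (e : sexpr) : sexpr :=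
  match e with
  | SCst c => SCst 0
  | SAdd e1 e2 => SAdd (sderiv j e1) (sderiv j e2)
  | SMul e1 e2 => SAdd (SMul e1 (sderiv j e2)) (SMul e2 (sderiv j e1))
  | SFlat m k b a i => SMul (SCst (b * (i == j)%:R))
      (SAdd (SMul (SCst (- k%:R)) (SFlat m k.+1 b a i))
            (SMul (SCst (m.+1%:R^-1)) (SFlat m k.+2 b a i)))
  end.

Lemma is_derive_seval e j (x : 'rV[R]_n) :
  is_derive x (delta_mx ord0 j : 'rV[R]_n) (seval e) (seval (sderiv j e) x).
Proof.
elim: e => [c|e1 IH1 e2 IH2|e1 IH1 e2 IH2|m k b a i] /=.
- exact: is_derive_cst.
- exact: (is_deriveD IH1 IH2).
- exact: (is_deriveM IH1 IH2).
- apply/is_derive_lineP.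
  have s0 : 0 < m.+1%:R^-1 :> R by rewrite invr_gt0.
  pose c : R := b * (i == j)%:R; pose d : R := b * x ord0 i + a.
  rewrite (_ : (fun t : R => _) = flat_exp m.+1%:R^-1 k \o (c \*: @id R + cst d)); last first.
    apply/funext => t /=; rewrite !mxE /c /d eqxx/=; congr (flat_exp _ _ _).
    by rewrite fctE/= /GRing.scale/=; ring.
  have dL : is_derive (0 : R) 1 (c \*: @id R + cst d) c.
    by apply: is_derive_eq; rewrite addr0 /GRing.scale/= mulr1.
  have E0 : (c \*: @id R + cst d) 0 = d by rewrite fctE/= scaler0 add0r.
  have dF := is_derive_flat_exp k ((c \*: @id R + cst d) 0) s0.
  by apply: is_derive_eq; rewrite E0 mulrC.
Qed.

Lemma continuous_flat_exp s k : 0 < s -> continuous (flat_exp (s : R) k).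
Proof.
move=> s0 t; apply/differentiable_continuous/derivable1_diffP.
have [dt _] := is_derive_flat_exp k t s0; exact: dt.
Qed.

Lemma continuous_seval e : continuous (seval e).
Proof.
elim: e => [c|e1 IH1 e2 IH2|e1 IH1 e2 IH2|m k b a i] x.
- exact: cst_continuous.
- exact: (continuousD (IH1 x) (IH2 x)).
- exact: (continuousM (IH1 x) (IH2 x)).
- have s0 : 0 < m.+1%:R^-1 :> R by rewrite invr_gt0.
  apply: (@continuous_comp _ _ _ (fun x : 'rV[R]_n => b * x ord0 i + a)
    (flat_exp (m.+1%:R^-1) k)); last exact: continuous_flat_exp.
  apply: (@continuousD _ _ _ (fun x : 'rV[R]_n => b * x ord0 i)); last exact: cst_continuous.
  apply: (@continuousM _ _ (cst b)); first exact: cst_continuous.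
  exact: coord_continuous.
Qed.

(** Iterated partial derivatives stay in the class, so smoothness reduces to the continuity and
    differentiability of [seval]. *)
Lemma foldr_partial_seval e s :
  foldr (@partial R n) (seval e) s = seval (foldr sderiv e s).
Proof.
elim: s => //= j s ->; apply/funext => x; rewrite /partial.
by have [] := is_derive_seval (foldr sderiv e s) j x.
Qed.

Lemma smooth_seval e : smooth (seval e).
Proof.
move=> s /=; rewrite foldr_partial_seval; split; first exact: continuous_seval.
by move=> i x; have [] := is_derive_seval (foldr sderiv e s) i x.
Qed.

Lemma partial_seval e j : partial j (seval e) = seval (sderiv j e).
Proof. exact: (foldr_partial_seval e [:: j]). Qed.

Fixpoint strans (v : 'rV[R]_n) (e : sexpr) : sexpr :=
  match e with
  | SCst c => SCst c
  | SAdd e1 e2 => SAdd (strans v e1) (strans v e2)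
  | SMul e1 e2 => SMul (strans v e1) (strans v e2)
  | SFlat m k b a i => SFlat m k b (b * v ord0 i + a) i
  end.

Lemma seval_strans v e x : seval (strans v e) x = seval e (x + v).
Proof.
elim: e => //= [e1 -> e2 -> //|e1 -> e2 -> //|m k b a i].
by rewrite mxE mulrDr addrA.
Qed.

Lemma compact_closure_box (A : set 'rV[R]_n) (M : R) :
  (forall x, A x -> forall i, `|x ord0 i| <= M) -> compact (closure A).
Proof.
move=> AM.
have cB := @rV_compact R n (fun=> `[- M, M]%classic) (fun=> @segment_compact R _ _).
apply: (subclosed_compact _ cB) => /=; first exact: closed_closure.
have sB : A `<=` [set v : 'rV[R]_n | forall i, `[- M, M]%classic (v ord0 i)].
  by move=> x Ax i; rewrite /= in_itv/= -ler_norml AM.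
have /closure_id -> := compact_closed (@norm_hausdorff _ _) cB.
exact: closureS sB.
Qed.

End smooth_expressions.

(** * Measurability of continuous functions *)

Section continuous_measurable.
Context (R : realType) (n : nat).

Let grid (k : nat) (x : 'rV[R]_n) : 'rV[int]_n :=
  \row_i Num.floor (k.+1%:R * x ord0 i).
Let ungrid (k : nat) (z : 'rV[int]_n) : 'rV[R]_n :=
  \row_i ((z ord0 i)%:~R / k.+1%:R).

Let measurable_grid k z : measurable [set x | grid k x = z].
Proof.
have -> : [set x | grid k x = z] =
    \bigcap_(i in [set: 'I_n]) [set x | Num.floor (k.+1%:R * x ord0 i) = z ord0 i].
  apply/seteqP; split => [x /= <- i _|x H]; first by rewrite mxE.
  by apply/rowP => i; rewrite mxE; exact: H.
apply: fin_bigcap_measurable => // i _; apply: (@measurable_rV_coord R n i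
  [set t | Num.floor (k.+1%:R * t) = z ord0 i]).
rewrite (_ : [set _ | _] = [set` `[(z ord0 i)%:~R / k.+1%:R, (z ord0 i + 1)%:~R / k.+1%:R[]).
  exact: measurable_itv.
apply/seteqP; split => t /=; rewrite in_itv/= ler_pdivrMr ?ltr_pdivlMr// ![t * _]mulrC.
  by move/eqP; rewrite floor_eq.
by rewrite -floor_eq => /eqP.
Qed.

(** The sigma-algebra is generated by the coordinates, so preimages of open sets are not measurable
    by definition. Rounding [x] down to the grid of step 1 / [k.+1] gives functions that are
    constant on countably many measurable cells, and continuity makes them converge to [f]. *)
Lemma rV_continuous_measurable (f : 'rV[R]_n -> R) :
  continuous f -> measurable_fun setT f.
Proof.
move=> cf; apply: (@measurable_fun_cvg _ _ _ _ (fun k x => f (ungrid k (grid k x)))).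
  move=> k _ B mB; rewrite setTI.
  rewrite (_ : _ @^-1` B =
    \bigcup_(z in [set z | B (f (ungrid k z))]) [set x | grid k x = z]).
    rewrite bigcup_mkcond; apply: countable_bigcupT_measurable => // z.
    by case: ifPn.
  apply/seteqP; split => [x /= Bx|x [z /= Bz zx]]; last by rewrite zx.
  by exists (grid k x).
move=> x _.
suff H : ungrid k (grid k x) @[k --> \oo] --> x by apply: (cvg_comp _ _ H); exact: cf.
apply/cvg_ballP => e e0; near=> k; split => // i j.
have k0 : 0 < k.+1%:R :> R by [].
rewrite /ball/= !mxE (ord1 i).
have /andP[f1 f2] := floor_itv (k.+1%:R * x ord0 j).
have H : k.+1%:R^-1 < e by near: k; exact: (near_infty_natSinv_lt (PosNum e0)).
apply: le_lt_trans H.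
rewrite -(@ler_pM2r _ k.+1%:R)// mulVf ?gt_eqF// -[X in _ * X](gtr0_norm k0) -normrM.
rewrite mulrBl divfK ?gt_eqF// mulrC ler_norml; apply/andP; split.
  by rewrite (@le_trans _ _ 0) ?subr_ge0// oppr_le0.
by rewrite lerBlDr addrC -[X in _ + X](_ : 1%:~R = _)// -intrD ltW.
Unshelve. all: by end_near. Qed.

End continuous_measurable.

(** * Square-integrable functions and density of test functions *)

Section square_integrable.
Context d (T : measurableType d) (R : realType) (mu : {measure set T -> \bar R}).
Implicit Types f g h : T -> R.

Local Notation integ f := (mu.-integrable setT (EFin \o f)).

Lemma integrable_measurable f : integ f -> measurable_fun setT f.
Proof. by move=> /measurable_int/measurable_EFinP. Qed.

Lemma integrable_dominated f g : measurable_fun setT f ->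
  (forall x, `|f x| <= g x) -> integ g -> integ f.
Proof.
move=> mf fg ig; apply: (le_integrable measurableT _ _ ig).
  exact/measurable_EFinP.
by move=> x _ /=; rewrite lee_fin (le_trans (fg x))// ler_norm.
Qed.

Lemma integrableDr f g : integ f -> integ g -> integ (fun x => f x + g x).
Proof. by move=> fi gi; exact: (integrableD measurableT fi gi). Qed.

Lemma integrableBr f g : integ f -> integ g -> integ (fun x => f x - g x).
Proof. by move=> fi gi; exact: (integrableB measurableT fi gi). Qed.

Lemma integrableZr (k : R) f : integ f -> integ (fun x => k * f x).
Proof. by move=> fi; exact: (integrableZl measurableT k fi). Qed.

Lemma integrable_sumr (I : Type) (s : seq I) (F : I -> T -> R) :
  (forall i, integ (F i)) -> integ (fun x => \sum_(i <- s) F i x).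
Proof.
move=> iF; elim: s => [|i s IHs].
  by under eq_fun do rewrite big_nil; exact: integrable0.
by under eq_fun do rewrite big_cons; exact: integrableDr.
Qed.

Lemma Rintegral_sum (I : Type) (s : seq I) (F : I -> T -> R) :
  (forall i, integ (F i)) ->
  \int[mu]_x (\sum_(i <- s) F i x) = \sum_(i <- s) \int[mu]_x F i x.
Proof.
move=> iF; elim: s => [|i s IHs].
  rewrite big_nil; under eq_Rintegral do rewrite big_nil.
  by rewrite Rintegral_cst// mul0r.
rewrite big_cons -IHs -RintegralD//; last exact: integrable_sumr.
by apply: eq_Rintegral => x _; rewrite big_cons.
Qed.

Lemma EFin_Rintegral f : integ f ->
  (\int[mu]_x f x)%:E = (\int[mu]_x (f x)%:E)%E.
Proof. by move=> fi; rewrite fineK//; exact: integrable_fin_num. Qed.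

Lemma Rintegral_dominated_cvg (F : nat -> T -> R) f g :
  (forall k, measurable_fun setT (F k)) ->
  (forall x, F k x @[k --> \oo] --> f x) ->
  (forall k x, `|F k x| <= g x) -> integ g ->
  \int[mu]_x F k x @[k --> \oo] --> \int[mu]_x f x.
Proof.
move=> mF Ff Fg ig.
have mf : measurable_fun setT f by apply: measurable_fun_cvg mF _ => x _.
have [] := @dominated_convergence _ _ _ mu setT measurableT
  (fun k => EFin \o F k) (EFin \o f) (EFin \o g).
- by move=> k; exact/measurable_EFinP.
- exact/measurable_EFinP.
- by apply: aeW => x _; apply: cvg_EFin; [exact: nearW|exact: Ff].
- exact: ig.
- by apply: aeW => x k _ /=; rewrite lee_fin.
move=> fi _ FE.
by apply: fine_cvg; rewrite fineK//; exact: integrable_fin_num.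
Qed.

Definition L2 f := measurable_fun setT f /\ integ (fun x => f x ^+ 2).

(** The squared L^2 norm as a real number, meaningful under [L2 f] because an infinite integral
    would be sent to 0. It is kept squared: [nsqD_le] plays the role of the triangle inequality, at
    the cost of a factor 2. *)
Definition nsq f : R := \int[mu]_x f x ^+ 2.

Lemma Lfun_L2 f : f \in Lfun mu 2%:E <-> L2 f.
Proof.
split=> [lf|[mf fi]].
  split; last exact: Lfun2_integrable_sqr.
  by move: lf; rewrite inE => /andP[]; rewrite inE.
rewrite inE; apply/andP; split; rewrite inE//=.
rewrite /finite_norm unlock/= poweR_lty//.
under eq_integral do rewrite powR_mulrn// ?real_normK ?num_real//.
by rewrite -EFin_Rintegral ?ltry.
Qed.

Lemma L2_mul f g : L2 f -> L2 g -> integ (fun x => f x * g x).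
Proof.
move=> [mf fi] [mg gi].
apply: integrable_dominated (integrableDr fi gi); first exact: measurable_funM.
move=> x; have := sqr_ge0 (f x + g x); have := sqr_ge0 (f x - g x).
have := sqr_ge0 (f x); have := sqr_ge0 (g x).
by rewrite ler_norml => ? ? ? ?; apply/andP; split; lra.
Qed.

Lemma L2D f g : L2 f -> L2 g -> L2 (fun x => f x + g x).
Proof.
move=> Lf Lg; have [mf fi] := Lf; have [mg gi] := Lg.
split; first exact: measurable_funD.
apply: integrable_dominated (integrableZr 2 (integrableDr fi gi)).
  by apply: measurable_funX; exact: measurable_funD.
move=> x; rewrite ger0_norm ?sqr_ge0//; have := sqr_ge0 (f x - g x); lra.
Qed.

Lemma L2Z k f : L2 f -> L2 (fun x => k * f x).
Proof.
move=> [mf fi]; split; first exact: measurable_funM.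
by under eq_fun do rewrite exprMn; exact: integrableZr.
Qed.

Lemma L2B f g : L2 f -> L2 g -> L2 (fun x => f x - g x).
Proof.
move=> Lf Lg; have := L2D Lf (L2Z (-1) Lg).
by under eq_fun do rewrite mulN1r.
Qed.

Lemma L2_bounded_mul f h (M : R) : measurable_fun setT h ->
  (forall x, `|h x| <= M) -> L2 f -> L2 (fun x => h x * f x).
Proof.
move=> mh hM [mf fi]; split; first exact: measurable_funM.
apply: integrable_dominated (integrableZr (M ^+ 2) fi).
  by apply: measurable_funX; exact: measurable_funM.
move=> x; rewrite ger0_norm ?sqr_ge0// exprMn ler_wpM2r ?sqr_ge0//.
by rewrite -real_normK ?num_real// lerXn2r ?nnegrE// (le_trans _ (hM x)).
Qed.

Lemma L2_dominated f g : measurable_fun setT f ->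
  (forall x, `|f x| <= g x) -> L2 g -> L2 f.
Proof.
move=> mf fg [mg gi]; split => //; apply: integrable_dominated gi.
  exact: measurable_funX.
move=> x; rewrite normrX lerXn2r ?nnegrE// (le_trans _ (fg x))//.
Qed.

Lemma nsq_ge0 f : 0 <= nsq f.
Proof. by apply: Rintegral_ge0 => x _; exact: sqr_ge0. Qed.

Lemma nsqD_le f g : L2 f -> L2 g ->
  nsq (fun x => f x + g x) <= 2 * (nsq f + nsq g).
Proof.
move=> Lf Lg; have [mf fi] := Lf; have [mg gi] := Lg.
rewrite /nsq -RintegralD// -RintegralZl//; last exact: integrableDr.
apply: le_Rintegral => //; first by have [] := L2D Lf Lg.
  by apply: integrableZr; exact: integrableDr.
by move=> x _; have := sqr_ge0 (f x - g x); lra.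
Qed.

Lemma nsqZ k f : L2 f -> nsq (fun x => k * f x) = k ^+ 2 * nsq f.
Proof.
by move=> [_ fi]; rewrite /nsq -RintegralZl//; under eq_Rintegral do rewrite exprMn.
Qed.

Lemma cauchy_schwarz f g : L2 f -> L2 g ->
  (\int[mu]_x (f x * g x)) ^+ 2 <= nsq f * nsq g.
Proof.
move=> Lf Lg; set c := \int[mu]_x (f x * g x).
have q t : 0 <= nsq f - 2 * t * c + t ^+ 2 * nsq g.
  rewrite -[X in _ <= X](_ : nsq (fun x => f x - t * g x) = _); first exact: nsq_ge0.
  have [mf fi] := Lf; have [mg gi] := Lg; have fgi := L2_mul Lf Lg.
  rewrite /nsq /c -!RintegralZl// -RintegralB//; last exact: integrableZr.
  rewrite -RintegralD//; [|by apply: integrableBr => //; exact: integrableZr|exact: integrableZr].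
  by apply: eq_Rintegral => x _; ring.
have f0 := nsq_ge0 f; have g0 := nsq_ge0 g.
have [gE|gN0] := eqVneq (nsq g) 0.
  rewrite gE mulr0; have [->|c0] := eqVneq c 0; first by rewrite expr0n.
  (* When [nsq g] vanishes the quadratic is affine in [t], and this [t] would give it the value -1.
     Otherwise its minimiser [c / nsq g] is used below. *)
  have := q ((nsq f + 1) / (2 * c)); rewrite gE mulr0 addr0.
  rewrite (_ : 2 * _ * c = nsq f + 1); last by field.
  by move=> H; exfalso; lra.
have gpos : 0 < nsq g by rewrite lt_def gN0.
have := q (c / nsq g).
rewrite -(pmulr_lge0 _ gpos) => H.
rewrite -subr_ge0; apply: le_trans H _.
by rewrite le_eqVlt; apply/orP; left; apply/eqP; field.
Qed.

Lemma nsq_cvg0 (F : nat -> T -> R) g :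
  (forall k, measurable_fun setT (F k)) ->
  (forall x, F k x @[k --> \oo] --> (0 : R)) ->
  (forall k x, `|F k x| <= g x) -> L2 g ->
  nsq (F k) @[k --> \oo] --> (0:R).
Proof.
move=> mF F0 Fg [mg gi].
rewrite [X in _ --> X](_ : _ = \int[mu]_x (cst 0 x)); last by rewrite Rintegral_cst// mul0r.
apply: Rintegral_dominated_cvg gi => [k|x|k x].
- exact: measurable_funX.
- rewrite [X in _ --> X](_ : _ = 0 * 0); last by rewrite mulr0.
  by under eq_fun do rewrite expr2; apply: cvgM.
- by rewrite normrX lerXn2r ?nnegrE// (le_trans _ (Fg k x)).
Qed.

Lemma nsq_small (F : nat -> T -> R) g (e : R) :
  (forall k, measurable_fun setT (F k)) ->
  (forall x, F k x @[k --> \oo] --> (0 : R)) ->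
  (forall k x, `|F k x| <= g x) -> L2 g -> 0 < e ->
  exists k, nsq (F k) <= e.
Proof.
move=> mF F0 Fg Lg e0; have := nsq_cvg0 mF F0 Fg Lg.
move=> /cvgrPdist_le /(_ e e0)[k _ /(_ k (leqnn k))].
by rewrite /= sub0r normrN ger0_norm ?nsq_ge0//; exists k.
Qed.

End square_integrable.

(** * Open boxes and the measurable sets they generate *)

Section density.
Context (R : realType) (n : nat).
Local Notation V := 'rV[R]_n.
Local Notation leb := (lebesgueN R n).

Definition obox (a c : 'I_n -> R) : set V :=
  [set x | forall i, a i < x ord0 i < c i].

Definition cube (k : nat) : set V := obox (fun=> - k.+1%:R) (fun=> k.+1%:R).

Definition oboxes : set (set V) := [set B | exists a c, B = obox a c].

Lemma measurable_obox a c : measurable (obox a c).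
Proof.
rewrite (_ : obox a c = \bigcap_(i in [set: 'I_n])
    [set x : V | [set t | a i < t < c i] (x ord0 i)]); last first.
  by apply/seteqP; split => [x H i _|x H i]; [exact: H|exact: (H i)].
apply: fin_bigcap_measurable => // i _; apply: measurable_rV_coord.
rewrite (_ : [set t | _] = [set` `]a i, c i[]); first exact: measurable_itv.
by apply/seteqP; split => t /=; rewrite in_itv.
Qed.

Lemma obox_setI a c a' c' : obox a c `&` obox a' c' =
  obox (fun i => Num.max (a i) (a' i)) (fun i => Num.min (c i) (c' i)).
Proof.
apply/seteqP; split => [x [H H'] i|x H].
  by have /andP[? ?] := H i; have /andP[? ?] := H' i; rewrite gt_max lt_min; apply/andP; split; apply/andP.
by split => i; have := H i; rewrite gt_max lt_min => /andP[/andP[? ?] /andP[? ?]]; apply/andP.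
Qed.

Lemma cube_exhaust (x : V) : exists N, forall k, (N <= k)%N -> cube k x.
Proof.
exists (Num.truncn (\sum_(i < n) `|x ord0 i|)) => k Nk i; rewrite -ltr_norml.
apply: (@le_lt_trans _ _ (\sum_(i < n) `|x ord0 i|)).
  by rewrite (bigD1 i)//= lerDl sumr_ge0.
by apply: lt_le_trans (truncnS_gt _) _; rewrite ler_nat.
Qed.

End density.

Lemma lebesgueN_cube_lty (R : realType) n (M : R) :
  (lebesgueN R n [set x | (forall i, `|x ord0 i| <= M)%R] < +oo)%E.
Proof.
elim: n => [|n IHn]; first by rewrite /= diracE ltry.
rewrite lebesgueN_succE.
set c := lebesgueN R n _ in IHn; have c0 : (0 <= c)%E by exact: measure_ge0.
rewrite (_ : (fun t : R => _) = (fun t => c * (\1_(`[- M, M]%classic) t)%:E)%E).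
  have mI : measurable_fun setT (EFin \o \1_(`[- M, M]%classic : set R) : R -> \bar R).
    by apply/measurable_EFinP; exact: measurable_indic.
  rewrite (ge0_integralZl lebesgue_measure measurableT mI)//; last by move=> x _; rewrite lee_fin.
  rewrite integral_indic// setIT.
  have lI : (lebesgue_measure (`[(- M)%R, M]%classic : set R) < +oo)%E.
    by rewrite lebesgue_measure_itv/=; case: ifPn; rewrite ?ltry// -EFinD ltry.
  by rewrite lte_mul_pinfty ?ge0_fin_numE.
apply/funext => t; rewrite indicE (_ : (t \in _) = (`|t| <= M)%R); last first.
  by apply/idP/idP; rewrite inE/= in_itv/= ler_norml.
have [tM|/negP tM] := boolP (`|t| <= M)%R.
  rewrite mule1; congr (lebesgueN R n _); apply/seteqP; split => y /= H i.
    by have := H (lift ord0 i); rewrite rV_consS.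
  by case: (unliftP ord0 i) => [j|] ->; rewrite ?rV_consS ?rV_cons0/=.
rewrite mule0 (_ : [set y | _] = set0) ?measure0//.
by apply/seteqP; split => // y /= /(_ ord0); rewrite rV_cons0.
Qed.

Section generation.
Context (R : realType) (n : nat).
Local Notation V := 'rV[R]_n.

(** Boxes are stable under intersection ([obox_setI]), so with this inclusion any lambda-system
    containing them contains every measurable set. The half-space where one coordinate exceeds [a]
    is a countable union of boxes. *)
Lemma measurable_sub_oboxes : 
  @measurable _ V `<=` <<s @oboxes R n >>.
Proof.
apply: smallest_sub; first exact: smallest_sigma_algebra.
rewrite -bigcup_seq => A [i _ [B mB <-]].
pose T := g_sigma_algebraType (@oboxes R n).
suff : measurable_fun [set: T] (fun x : T => (x : V) ord0 i) by move=> /(_ measurableT B mB).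
apply: (measurability _ (RGenOInfty.measurableE R)) => //.
move=> _ [_ [a ->] <-]; rewrite setTI.
rewrite (_ : _ @^-1` _ = \bigcup_k obox
   (fun j : 'I_n => if j == i then a else - k.+1%:R)
   (fun j => if j == i then a + k.+1%:R else k.+1%:R)).
  apply: bigcupT_measurable => k; apply: sub_sigma_algebra; eexists; eexists; reflexivity.
apply/seteqP; split => [x /=|x [k _ /(_ i)]]; last first.
  by rewrite eqxx /= in_itv/= andbT => /andP[].
rewrite in_itv/= andbT => ax.
have [N HN] := cube_exhaust x.
exists (maxn N (Num.truncn (x ord0 i - a))) => // j; case: ifPn => [/eqP ->|_].
  rewrite ax/= -ltrBlDl; apply: lt_le_trans (truncnS_gt _) _.
  by rewrite ler_nat ltnS leq_maxr.
by apply: HN; exact: leq_maxl.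
Qed.

End generation.

(** * Density of compactly supported expressions in L^2 *)

Section approximable.
Context (R : realType) (n : nat).
Local Notation V := 'rV[R]_n.
Local Notation leb := (lebesgueN R n).

Definition box_supported (f : V -> R) :=
  exists M, forall (x : V) (i : 'I_n), M < `|x ord0 i| -> f x = 0.

(** The approximants are values of expressions, not arbitrary test functions, so that translating
    and differentiating them are operations on syntax. *)
Definition approximable (v : V -> R) := L2 leb v /\ forall e, 0 < e ->
  exists s : sexpr R n, [/\ L2 leb (seval s), box_supported (seval s) &
    nsq leb (fun x => v x - seval s x) <= e].

Lemma approximable_closed v : L2 leb v ->
  (forall e, 0 < e -> exists2 w, approximable w &
    nsq leb (fun x => v x - w x) <= e) -> approximable v.
Proof.
(* The factor 2 of [nsqD_le] turns two errors [e / 4] into [e]. *)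
move=> Lv vw; split => // e e0; have e40 : 0 < e / 4 by rewrite divr_gt0.
have [w [Lw ws] vwe] := vw _ e40; have [s [Ls bs wse]] := ws _ e40.
exists s; split => //.
rewrite (_ : (fun x => v x - seval s x) =
    (fun x => (v x - w x) + (w x - seval s x))); last first.
  by apply/funext => x; rewrite addrA subrK.
by apply: le_trans (nsqD_le (L2B Lv Lw) (L2B Lw Ls)) _; lra.
Qed.

Lemma approximableD v w : approximable v -> approximable w ->
  approximable (fun x => v x + w x).
Proof.
move=> [Lv va] [Lw wa]; split; first exact: L2D.
move=> e e0; have e40 : 0 < e / 4 by rewrite divr_gt0.
have [s [Ls [M sM] vs]] := va _ e40; have [s' [Ls' [M' sM'] vs']] := wa _ e40.
exists (SAdd s s'); split => /=; first exact: L2D.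
  exists (Num.max M M') => x i; rewrite gt_max => /andP[? ?].
  by rewrite (sM x i)// (sM' x i)// addr0.
rewrite (_ : (fun x => _) =
    (fun x => (v x - seval s x) + (w x - seval s' x))); last first.
  by apply/funext => x; ring.
by apply: le_trans (nsqD_le (L2B Lv Ls) (L2B Lw Ls')) _; lra.
Qed.

Lemma approximableZ k v : approximable v -> approximable (fun x => k * v x).
Proof.
move=> [Lv va]; split; first exact: L2Z.
move=> e e0; have k0 : 0 < k ^+ 2 + 1 by have := sqr_ge0 k; lra.
have [s [Ls [M sM] vs]] := va _ (divr_gt0 e0 k0).
exists (SMul (SCst _ k) s); split => /=; first exact: L2Z.
  by exists M => x i Mx; rewrite (sM x i)// mulr0.
rewrite (_ : (fun x => _) = (fun x => k * (v x - seval s x))); last first.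
  by apply/funext => x; rewrite mulrBr.
rewrite nsqZ; last exact: L2B.
apply: le_trans (ler_wpM2l (sqr_ge0 k) vs) _.
by rewrite mulrA ler_pdivrMr//; lra.
Qed.

Lemma approximableB v w : approximable v -> approximable w ->
  approximable (fun x => v x - w x).
Proof.
move=> av aw; have := approximableD av (approximableZ (-1) aw).
by under eq_fun do rewrite mulN1r.
Qed.

Lemma approximable0 : approximable (cst 0).
Proof.
have E : nsq leb (cst 0) = 0.
  by rewrite /nsq; under eq_Rintegral do rewrite expr0n; rewrite Rintegral_cst// mul0r.
have L0 : L2 leb (cst 0).
  split => //; under eq_fun do rewrite expr0n; exact: integrable0.
split => // e e0; exists (SCst n 0); split => //=; first by exists 0.
by under eq_fun do rewrite subrr; rewrite [X in X <= _]E ltW.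
Qed.

Lemma approximable_sum (I : Type) (r : seq I) (F : I -> V -> R) :
  (forall i, approximable (F i)) -> approximable (fun x => \sum_(i <- r) F i x).
Proof.
move=> aF; elim: r => [|i r IHr].
  by under eq_fun do rewrite big_nil; exact: approximable0.
by under eq_fun do rewrite big_cons; exact: approximableD.
Qed.

Lemma L2_indic (A : set V) (M : R) : measurable A ->
  (forall x, A x -> forall i, `|x ord0 i| <= M) -> L2 leb \1_A.
Proof.
move=> mA AM; split; first exact: measurable_indic.
have mB : measurable [set x : V | forall i, `|x ord0 i| <= M].
  rewrite (_ : [set x : V | _] = \bigcap_(i in [set: 'I_n])
      [set x : V | [set t | `|t| <= M] (x ord0 i)]); last first.
    by apply/seteqP; split => [x H i _|x H i]; [exact: H|exact: (H i)].
  apply: fin_bigcap_measurable => // i _; apply: measurable_rV_coord.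
  rewrite (_ : [set t | _] = [set` `[- M, M]]); first exact: measurable_itv.
  by apply/seteqP; split => t /=; rewrite in_itv/= ler_norml.
rewrite (_ : (fun x => \1_A x ^+ 2) = \1_A); last first.
  by apply/funext => x; rewrite indicE; case: (_ \in _); rewrite ?expr1n ?expr0n.
apply/integrableP; split; first by apply/measurable_EFinP; exact: measurable_indic.
rewrite (eq_integral (fun x => (\1_A x)%:E)); last first.
  by move=> x _; rewrite /= ger0_norm.
rewrite integral_indic// setIT; apply: le_lt_trans (lebesgueN_cube_lty n M).
by apply: le_measure; rewrite ?inE.
Qed.

(* The power [1 / m.+1] of a bump function positive exactly on the box: it
   increases to the indicator of the box as [m] grows. *)
Definition sbump_over (r : seq 'I_n) (m : nat) (a c : 'I_n -> R) : sexpr R n :=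
  foldr (fun i => SMul (SMul (SFlat m 0 1 (- a i) i) (SFlat m 0 (-1) (c i) i)))
    (SCst n 1) r.

Lemma flat_exp0E s (t : R) : 0 < t -> flat_exp s 0 t = expR (- s / t).
Proof. by move=> t0; rewrite /flat_exp t0 expr0 invr1 mul1r. Qed.

Lemma seval_sbump_in r m a c (x : V) : obox a c x ->
  seval (sbump_over r m a c) x = expR (- m.+1%:R^-1 *
    \sum_(i <- r) ((x ord0 i - a i)^-1 + (c i - x ord0 i)^-1)).
Proof.
move=> xB; elim: r => [|i r IHr]; first by rewrite /= big_nil mulr0 expR0.
rewrite /= IHr big_cons; have /andP[ax xc] := xB i.
rewrite !flat_exp0E -?expRD; last 2 first.
  by rewrite mulN1r addrC subr_gt0.
  by rewrite mul1r subr_gt0.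
by congr expR; rewrite mul1r mulN1r [- _ + c i]addrC; ring.
Qed.

Lemma seval_sbump_out r m a c (x : V) i : i \in r -> ~~ (a i < x ord0 i < c i) ->
  seval (sbump_over r m a c) x = 0.
Proof.
move=> + xi; elim: r => // j r IHr; rewrite inE => /predU1P[<-|/IHr E] /=.
  rewrite /flat_exp mul1r mulN1r subr_gt0 [- _ + c i]addrC subr_gt0.
  by move: xi; rewrite negb_and => /orP[|] /negbTE ->; rewrite ?mulr0 ?mul0r.
by rewrite E mulr0.
Qed.

Lemma approximable_obox a c : approximable \1_(obox a c).
Proof.
pose M := \sum_i (`|a i| + `|c i|).
have BM x : obox a c x -> forall i, `|x ord0 i| <= M.
  move=> xB i; have /andP[ax xc] := xB i.
  apply: (@le_trans _ _ (`|a i| + `|c i|)).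
    rewrite ler_norml; have := ler_norm (c i); have := normr_ge0 (a i).
    have := normr_ge0 (c i); have := ler_norm (- a i); rewrite normrN.
    by move=> *; apply/andP; split; lra.
  by rewrite /M (bigD1 i)//= lerDl sumr_ge0// => j _; rewrite addr_ge0.
have LB : L2 leb \1_(obox a c) by apply: L2_indic BM; exact: measurable_obox.
pose b m := sbump_over (index_enum 'I_n) m a c.
have b_out m x : ~ obox a c x -> seval (b m) x = 0.
  move=> /existsNP[i /negP xi]; apply: seval_sbump_out xi.
  by rewrite mem_index_enum.
have b01 m x : 0 <= seval (b m) x <= \1_(obox a c) x.
  have [xB|xB] := pselect (obox a c x); last by rewrite b_out// lexx indicE/=.
  rewrite indicE mem_set// seval_sbump_in// expR_ge0/= -expR0 ler_expR.
  rewrite mulNr oppr_le0 mulr_ge0// sumr_ge0// => i _.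
  by have /andP[? ?] := xB i; rewrite addr_ge0// invr_ge0 subr_ge0 ltW.
have mb m : measurable_fun setT (seval (b m)).
  by apply: rV_continuous_measurable; exact: continuous_seval.
split => // e e0.
have Lb m : L2 leb (seval (b m)).
  apply: (L2_dominated (mb m) _ LB) => x.
  by have /andP[? ?] := b01 m x; rewrite ger0_norm.
have [m Hm] : exists m, nsq leb (fun x => \1_(obox a c) x - seval (b m) x) <= e.
  apply: (nsq_small _ _ _ LB) => // [m|x|m x].
  - by apply: measurable_funB => //; exact: measurable_indic (measurable_obox _ _).
  - have [xB|xB] := pselect (obox a c x); last first.
      rewrite (_ : (fun m => _) = cst 0); first exact: cvg_cst.
      by apply/funext => m; rewrite b_out// indicE memNset// subrr.
    pose S := \sum_i ((x ord0 i - a i)^-1 + (c i - x ord0 i)^-1).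
    (* Inside the box the gap is 1 - exp(- S / [m.+1]), which lies between 0 and S / [m.+1]. *)
    apply: (@squeeze_cvgr _ _ _ _ (cst 0) (fun m => m.+1%:R^-1 * S)).
    + near=> m; have /andP[_] := b01 m x; rewrite subr_ge0 => -> /=.
      rewrite indicE mem_set//= seval_sbump_in//.
      rewrite -/S mulNr; have := expR_ge1Dx (- (m.+1%:R^-1 * S)).
      move=> H; rewrite lerBlDr addrC -lerBlDr; exact: H.
    + exact: cvg_cst.
    + rewrite -[X in _ --> X](mul0r S); apply: cvgM; last exact: cvg_cst.
      exact: cvg_harmonic.
  - have /andP[? ?] := b01 m x; rewrite ger0_norm ?subr_ge0//.
    by rewrite lerBlDr lerDl.
exists (b m); split => //; exists M => x i Mx; apply: b_out => /BM /(_ i).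
by rewrite leNgt Mx.
Unshelve. all: by end_near. Qed.

(** A Dynkin class argument from the pi-system of boxes. The intersection with a cube keeps all
    indicators square integrable, in particular those of complements, and the property is carried
    for all cubes at once through the class. *)
Lemma approximable_indic (A : set V) k : measurable A ->
  approximable \1_(A `&` @cube R n k).
Proof.
move=> mA; suff : measurable A /\ forall k, approximable \1_(A `&` @cube R n k).
  by case=> _; exact.
have LQ j (B : set V) : measurable B -> L2 leb \1_(B `&` @cube R n j).
  move=> mB; apply: (@L2_indic _ j.+1%:R).
    by apply: measurableI => //; exact: measurable_obox.
  by move=> x [_ xQ] i; rewrite ler_norml; have /andP[/ltW-> /ltW->] := xQ i.
have := measurable_sub_oboxes mA; move: A {mA}.
apply: (@lambda_system_subset _ (@oboxes R n) _ setT
  [set A | measurable A /\ forall k, approximable \1_(A `&` @cube R n k)]) => //.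
- by move=> _ _ [a [c ->]] [a' [c' ->]]; rewrite obox_setI; eexists; eexists.
- split => //.
  + by split => // j; rewrite setTI; exact: approximable_obox.
  + move=> A B BA [mA aA] [mB aB]; split; first exact: measurableD.
    move=> j; rewrite (_ : \1_ _ = fun x => \1_(A `&` @cube R n j) x - \1_(B `&` @cube R n j) x).
      exact: approximableB.
    apply/funext => x; rewrite !indicI /= -mulrBl; congr (_ * _); rewrite !indicE.
    have [xB|xB] := pselect (B x).
      rewrite (mem_set xB) (mem_set (BA _ xB)) (@memNset _ (fun y => ~ B y)).
        by rewrite mulr0 subrr.
      exact.
    by rewrite (memNset xB) subr0 (@mem_set _ (fun y => ~ B y))// mulr1.
  + move=> F ndF HF.
    have mF : measurable (\bigcup_i F i) by apply: bigcupT_measurable => i; case: (HF i).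
    split => // j; apply: approximable_closed; first exact: LQ.
    move=> e e0.
    have [m Hm] : exists m, nsq leb (fun x =>
        \1_(\bigcup_i F i `&` @cube R n j) x - \1_(F m `&` @cube R n j) x) <= e.
      apply: (nsq_small _ _ _ (LQ j setT measurableT)) => // [m|x|m x].
      * by apply: measurable_funB; apply: measurable_indic; apply: measurableI => //;
          [exact: measurable_obox|case: (HF m)|exact: measurable_obox].
      * have [[i _ Fix]|xF] := pselect ((\bigcup_i F i) x); last first.
          rewrite (_ : (fun m => _) = cst 0); first exact: cvg_cst.
          apply/funext => m; rewrite !indicE !memNset ?subrr// => -[Fx _]//.
          by apply: xF; exists m.
        apply: cvg_near_cst; near=> m.
        have im : (i <= m)%N by near: m; exact: nbhs_infty_ge.
        have Fm : F m x by move: Fix; exact/subsetPset/ndF.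
        have UFx : (\bigcup_i F i) x by exists i.
        by rewrite !indicI /= -mulrBl !indicE (mem_set Fm) (mem_set UFx) subrr mul0r.
      * rewrite setTI !indicI /= -mulrBl !indicE.
        have [Fx|Fx] := pselect (F m x).
          have UFx : (\bigcup_i F i) x by exists m.
          by rewrite (mem_set Fx) (mem_set UFx) subrr mul0r normr0.
        by rewrite (memNset Fx) subr0; do 2 case: (_ \in _);
          rewrite ?mulr1 ?mulr0 ?normr1 ?normr0.
    by exists \1_(F m `&` @cube R n j) => //; case: (HF m).
- move=> _ [a [c ->]]; split; first exact: measurable_obox.
  by move=> j; rewrite obox_setI; exact: approximable_obox.
Unshelve. all: by end_near. Qed.

Import HBNNSimple.

Lemma approximable_ge0 v : (forall x, 0 <= v x) -> L2 leb v -> approximable v.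
Proof.
move=> v0 Lv; have [mv vi] := Lv; apply: approximable_closed => // e e0.
have mEv : measurable_fun setT (EFin \o v) by exact/measurable_EFinP.
pose f := nnsfun_approx measurableT mEv.
have fv m x : 0 <= f m x <= v x.
  apply/andP; split; first exact: fun_ge0.
  by rewrite -lee_fin /f nnsfun_approxE; apply: le_approx => // y _; rewrite lee_fin.
(* Level sets are known to be approximable only inside a cube; the cube grows with [m], so that the
   truncated simple functions still converge to [v]. *)
pose w m := (fun x => f m x * \1_(@cube R n m) x).
have wv m x : 0 <= w m x <= v x.
  have /andP[f0 fv'] := fv m x; rewrite /w indicE.
  by case: (_ \in _); rewrite ?mulr1 ?mulr0 ?f0 ?lexx ?v0.
have aw m : approximable (w m).
  rewrite (_ : w m = fun x => \sum_(y <- finmap.enum_fset (fset_set (range (f m))))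
    (y * \1_(f m @^-1` [set y] `&` @cube R n m) x)).
    apply: approximable_sum => y; apply: approximableZ; apply: approximable_indic.
    have mf : measurable_fun setT (f m) by exact: measurable_funP.
    by have := mf measurableT _ (measurable_set1 y); rewrite setTI.
  apply/funext => x; rewrite /w (fimfunE (f m)) fsbig_finite//= mulr_suml.
  by apply: eq_bigr => i _; rewrite -mulrA indicI.
have [m Hm] : exists m, nsq leb (fun x => v x - w m x) <= e.
  apply: (nsq_small _ _ _ Lv) => // [m|x|m x].
  - by apply: measurable_funB => //; have [[]] := aw m.
  - rewrite -[X in _ --> X](subrr (v x)); apply: cvgB; first exact: cvg_cst.
    have [N HN] := cube_exhaust x.
    apply: (@cvg_trans _ (f m x @[m --> \oo])).
      apply: near_eq_cvg; near=> m; rewrite /w indicE mem_set ?mulr1//; apply: HN.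
      by near: m; exact: nbhs_infty_ge.
    have : EFin \o f^~ x @ \oo --> (v x)%:E.
      by apply: (cvg_nnsfun_approx measurableT mEv) => // y _; rewrite lee_fin.
    by move/fine_cvg.
  - by have /andP[? ?] := wv m x; rewrite ger0_norm ?subr_ge0// lerBlDr lerDl.
by exists (w m).
Unshelve. all: by end_near. Qed.

Lemma approximable_L2 v : L2 leb v -> approximable v.
Proof.
move=> Lv; have [mv vi] := Lv.
rewrite (_ : v = fun x => Num.max (v x) 0 - Num.max (- v x) 0); last first.
  by apply/funext => x; case: (leP (v x) 0) => ?; case: (leP (- v x) 0) => ?; lra.
have mm : measurable_fun setT (fun x => Num.max (v x) 0) by exact: measurable_maxr.
have mN : measurable_fun setT (fun x => Num.max (- v x) 0).
  by apply: measurable_maxr => //; exact: measurable_funN.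
have Ln : L2 leb (fun x => `|v x|).
  by split; [exact: measurableT_comp|under eq_fun do rewrite real_normK ?num_real//].
apply: approximableB; apply: approximable_ge0.
- by move=> x; rewrite le_max lexx orbT.
- apply: (L2_dominated mm _ Ln) => x; rewrite ger0_norm ?le_max ?lexx ?orbT//.
  by rewrite ge_max ler_norm normr_ge0.
- by move=> x; rewrite le_max lexx orbT.
- apply: (L2_dominated mN _ Ln) => x; rewrite ger0_norm ?le_max ?lexx ?orbT//.
  by rewrite ge_max -normrN ler_norm normr_ge0.
Qed.

End approximable.

(** * Translations and weak derivatives *)

Section translation.
Context (R : realType) (n : nat) (i : 'I_n).
Local Notation V := 'rV[R]_n.
Local Notation leb := (lebesgueN R n).
Local Notation e_i := (delta_mx ord0 i : V).

Lemma Rintegral_shift (v : V) (f : V -> R) : measurable_fun setT f ->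
  \int[leb]_x f (x + v) = \int[leb]_x f x.
Proof.
move=> mf; congr fine; apply: (@integral_shift R n v (EFin \o f)).
exact/measurable_EFinP.
Qed.

Lemma measurable_shift (v : V) (f : V -> R) : measurable_fun setT f ->
  measurable_fun setT (fun x : V => f (x + v)).
Proof. by move=> mf; apply: (measurableT_comp mf); exact: measurable_rV_shift. Qed.

Lemma L2_shift (v : V) (f : V -> R) : L2 leb f -> L2 leb (fun x => f (x + v)).
Proof.
move=> [mf fi]; split; first exact: measurable_shift.
exact: (@integrable_shift R n v (EFin \o (fun x => f x ^+ 2))).
Qed.

Lemma nsq_shift (v : V) (f : V -> R) : measurable_fun setT f ->
  nsq leb (fun x => f (x + v)) = nsq leb f.
Proof.
move=> mf; apply: (@Rintegral_shift v (fun x => f x ^+ 2)).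
exact: measurable_funX.
Qed.

(** The shift sits on the differentiable factor [f], so that nothing beyond measurability is asked
    of [w] alone. [K] dominates the derivative for all [t] within distance 1 of [a]; the sign comes
    from the shift by [- t]. *)
Lemma is_derive_shift_integral (w f f' K : V -> R) (a : R) :
  measurable_fun setT w -> measurable_fun setT f' ->
  (forall x, is_derive x e_i f (f' x)) ->
  (forall t, leb.-integrable setT (EFin \o (fun x => w x * f (x - t *: e_i)))) ->
  leb.-integrable setT (EFin \o K) ->
  (forall t x, `|t - a| < 1 -> `|w x * f' (x - t *: e_i)| <= K x) ->
  is_derive a 1 (fun t => \int[leb]_x (w x * f (x - t *: e_i)))
    (- \int[leb]_x (w x * f' (x - a *: e_i))).
Proof.
move=> mw mf' df iwf iK Kb; pose F (t : R) (x : V) := w x * f (x - t *: e_i).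
have dF (t : R) (x : V) : is_derive t 1 (F ^~ x) (- (w x * f' (x - t *: e_i))).
  rewrite (_ : F ^~ x = w x \*: ((fun s => f (s *: e_i + x)) \o -%R)); last first.
    by apply/funext => s; rewrite /F /= scaleNr [- _ + x]addrC.
  have dl : is_derive (- t) 1 (fun s : R => f (s *: e_i + x)) (f' (x - t *: e_i)).
    apply: is_derive_line; rewrite scaleNr [- _ + x]addrC; exact: df.
  have dN : is_derive t (1 : R) (-%R : R -> R) (- 1) by exact: is_deriveNid.
  have dc := @is_derive1_comp R _ _ t _ _ dl dN.
  apply: is_derive_eq.
  by rewrite /GRing.scale/= mulrN1 mulrN.
have aI : `]a - 1, a + 1[%classic a by rewrite /= in_itv/= ltrBlDr ltrDl ltr01.
have itvE t : `]a - 1, a + 1[%classic t -> `|t - a| < 1.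
  by rewrite /= in_itv/= ltr_distl.
have p1 (t : R) (x : V) : partial1of2 F t x = - (w x * f' (x - t *: e_i)).
  by rewrite partial1of2E; have [] := dF t x.
have K0 x : 0 <= K x.
  by apply: le_trans (Kb a x _); rewrite ?normr_ge0// subrr normr0.
have H1 : forall x y, `]a - 1, a + 1[%classic x -> [set: V] y -> derivable (F ^~ y) x 1.
  by move=> x y _ _; have [] := dF x y.
have H2 : forall x y, `]a - 1, a + 1[%classic x -> [set: V] y -> `|partial1of2 F x y| <= K y.
  by move=> x y /itvE xa _; rewrite p1 normrN Kb.
have iF : forall x, `]a - 1, a + 1[%classic x -> leb.-integrable setT (EFin \o F x).
  by move=> x _; exact: iwf.
apply: DeriveDef.
  exact: (derivable_under_integral measurableT aI iF H1 K0 iK H2).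
rewrite -derive1E (differentiation_under_integral measurableT aI iF H1 K0 iK H2).
rewrite (_ : - _ = \int[leb]_y (-1 * (w y * f' (y - a *: e_i)))).
  by apply: eq_Rintegral => x _; rewrite p1 mulN1r.
rewrite RintegralZl ?mulN1r//.
apply: integrable_dominated iK.
  by apply: measurable_funM => //; exact: measurable_shift.
by move=> x; apply: Kb; rewrite subrr normr0.
Qed.

End translation.

(** * Functions with bounded support *)

Section box_support.
Context (R : realType) (n : nat) (i : 'I_n).
Local Notation V := 'rV[R]_n.
Local Notation leb := (lebesgueN R n).
Local Notation e_i := (delta_mx ord0 i : V).

Lemma norm_coord_le (x : V) j : `|x ord0 j| <= `|x|.
Proof.
rewrite {2}/Num.norm/= mx_normrE.
exact: (@le_bigmax _ _ _ 0 (fun ij : 'I_1 * 'I_n => `|x ij.1 ij.2|) (ord0, j)).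
Qed.

Lemma compact_box_supported (f : V -> R) :
  compact (closure [set x | f x != 0]) -> box_supported f.
Proof.
move=> /compact_bounded[M [_ HM]]; exists (M + 1) => x j Mx.
apply/eqP/negPn/negP => fx.
have M1 : M < M + 1 by rewrite ltrDl.
have cx : closure [set x | f x != 0] x by exact: subset_closure.
have /= := HM _ M1 x cx; apply/negP; rewrite -ltNge.
by apply: (lt_le_trans Mx); exact: norm_coord_le.
Qed.

Lemma box_supported_test (s : sexpr R n) :
  box_supported (seval s) -> test_function (seval s).
Proof.
move=> [M sM]; split; first exact: smooth_seval.
apply: (@compact_closure_box R n _ M) => x /= sx j.
by rewrite leNgt; apply: contra sx => /(sM x j) ->.
Qed.

Lemma box_supported_bounded (f : V -> R) : continuous f -> box_supported f ->
  exists C : R, forall x, `|f x| <= C.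
Proof.
move=> cf [M fM].
have cB := @rV_compact R n (fun=> `[- M, M]%classic) (fun=> @segment_compact R _ _).
have /compact_bounded[C [_ HC]] := continuous_compact (continuous_subspaceT cf) cB.
exists (Num.max (C + 1) 0) => x; rewrite le_max.
have [xB|/existsNP[j]] := pselect (forall j, `[- M, M]%classic (x ord0 j)).
  apply/orP; left; apply: (HC (C + 1)); first by rewrite ltrDl.
  by exists x.
rewrite /= in_itv/= -ler_norml => /negP; rewrite -ltNge => /(fM x j) ->.
by rewrite normr0 lexx orbT.
Qed.

Lemma box_supported_shift_bound (f : V -> R) (a : R) :
  continuous f -> box_supported f -> exists K : V -> R,
  [/\ L2 leb K, leb.-integrable setT (EFin \o K) &
    forall t x, `|t - a| < 1 -> `|f (x - t *: e_i)| <= K x].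
Proof.
move=> cf bf; have [C fC] := box_supported_bounded cf bf; have [M fM] := bf.
have C0 : 0 <= C by apply: le_trans (fC 0); exact: normr_ge0.
pose k := Num.truncn (M + `|a| + 1).
have [Lk _] := @approximable_obox R n (fun=> - k.+1%:R) (fun=> k.+1%:R).
exists (fun x => C * \1_(@cube R n k) x); split; first exact: L2Z.
  apply: integrableZr; have [_] := Lk.
  rewrite (_ : (fun x => \1__ x ^+ 2) = \1_(@cube R n k))//; apply/funext => x.
  by rewrite indicE; case: (_ \in _); rewrite ?expr1n ?expr0n.
move=> t x ta; have [xk|/existsNP[j]] := pselect (@cube R n k x).
  by rewrite indicE mem_set// mulr1.
move=> /negP; rewrite -ltr_norml -leNgt => kx.
rewrite (fM _ j) ?normr0; first by rewrite mulr_ge0.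
have Mk : M + `|a| + 1 < `|x ord0 j| by apply: lt_le_trans (truncnS_gt _) kx.
rewrite !mxE eqxx/=.
have tj : `|t * (j == i)%:R| < `|a| + 1.
  have : `|t| < `|a| + 1 by have := ler_normD (t - a) a; rewrite subrK; lra.
  by case: eqP => _; rewrite ?mulr1 ?mulr0 ?normr0//; have := normr_ge0 a; lra.
have := ler_normD (x ord0 j - t * (j == i)%:R) (t * (j == i)%:R).
rewrite subrK; lra.
Qed.

Lemma box_supported_L2 (f : V -> R) : continuous f -> box_supported f -> L2 leb f.
Proof.
move=> cf bf; have [C fC] := box_supported_bounded cf bf; have [M fM] := bf.
have mf := rV_continuous_measurable cf.
pose k := Num.truncn M.
have [Lk _] := @approximable_obox R n (fun=> - k.+1%:R) (fun=> k.+1%:R).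
apply: (L2_dominated mf _ (L2Z C Lk)) => x.
have [xk|/existsNP[j]] := pselect (@cube R n k x).
  by rewrite indicE mem_set// mulr1.
move=> /negP; rewrite -ltr_norml -leNgt => kx.
rewrite (fM x j) ?normr0; last exact: lt_le_trans (truncnS_gt _) kx.
by rewrite mulr_ge0// (le_trans _ (fC 0)).
Qed.

Lemma box_supported_partial (f f' : V -> R) :
  (forall x, is_derive x e_i f (f' x)) -> box_supported f -> box_supported f'.
Proof.
(* The margin 1 keeps a whole segment of the coordinate line through [x] outside the support of
   [f]. *)
move=> df [M fM]; exists (M + 1) => x j Mx.
have /is_derive_lineP[_ <-] := df x.
suff : is_derive (0:R) 1 (fun t : R => f (t *: e_i + x)) 0 by case.
have dc : is_derive (0:R) (1:R) (cst 0 : R -> R) (0:R) by exact: is_derive_cst.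
apply: (near_eq_is_derive _ dc).
near=> t; rewrite /= (fM _ j)// !mxE eqxx/=.
have t1 : `|t| < 1 by near: t; exact: (@nbhs0_lt R R^o).
have : `|t * (j == i)%:R| < 1.
  by case: eqP => _; rewrite ?mulr1 ?mulr0 ?normr0// ltr01.
have := ler_normB (t * (j == i)%:R + x ord0 j) (t * (j == i)%:R).
rewrite [_ + x ord0 j]addrC addrK; lra.
Unshelve. all: by end_near. Qed.

End box_support.

(** * Translates of a function with a weak derivative *)

Section weak_derivative.
Context (R : realType) (n : nat) (i : 'I_n).
Local Notation V := 'rV[R]_n.
Local Notation leb := (lebesgueN R n).
Local Notation e_i := (delta_mx ord0 i : V).
Variables (u g : V -> R).
Hypotheses (Lu : L2 leb u) (Lg : L2 leb g).
Hypothesis ug : forall phi, test_function phi ->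
  (\int[leb]_x (u x * partial i phi x)%:E = - \int[leb]_x (g x * phi x)%:E)%E.

Lemma weak_derivative_seval (s : sexpr R n) : box_supported (seval s) ->
  \int[leb]_x (u x * seval (sderiv i s) x) = - \int[leb]_x (g x * seval s x).
Proof.
move=> bs; have := ug (box_supported_test bs).
rewrite partial_seval => /(congr1 fine); rewrite fineN.
by [].
Qed.

Let L2_seval (s : sexpr R n) : box_supported (seval s) -> L2 leb (seval s).
Proof. by move=> bs; apply: box_supported_L2 => //; exact: continuous_seval. Qed.

Let box_strans (s : sexpr R n) v : box_supported (seval s) ->
  box_supported (seval (strans v s)).
Proof.
move=> [M sM]; exists (M + `|v|) => x j Mx; rewrite seval_strans (sM _ j)// mxE.
have := norm_coord_le v j; have := ler_normB (x ord0 j + v ord0 j) (v ord0 j).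
rewrite addrK; lra.
Qed.

Let box_sderiv (s : sexpr R n) : box_supported (seval s) ->
  box_supported (seval (sderiv i s)).
Proof.
by move=> bs; apply: (box_supported_partial (is_derive_seval s i) bs).
Qed.

(** Differentiating under the integral puts the derivative on the translated expression, which is
    again an admissible test function; since [sderiv] commutes with [strans], the weak derivative
    moves it onto [g]. The formula holds at every [a], as the mean value theorem requires. *)
Lemma is_derive_shift_seval (s : sexpr R n) (a : R) : box_supported (seval s) ->
  is_derive a 1 (fun t => \int[leb]_x (u x * seval s (x - t *: e_i)))
    (\int[leb]_x (g x * seval s (x - a *: e_i))).
Proof.
move=> bs; have [mu_ _] := Lu.
have bs' := box_sderiv bs; have Ls' := L2_seval bs'.
have [K [LK _ sK]] :=
  box_supported_shift_bound i a (@continuous_seval R n (sderiv i s)) bs'.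
have Lau : L2 leb (fun x => `|u x|).
  have [mu' iu] := Lu; split; first exact: measurableT_comp.
  by under eq_fun do rewrite real_normK ?num_real//.
have E : - (\int[leb]_x (u x * seval (sderiv i s) (x - a *: e_i))) =
    \int[leb]_x (g x * seval s (x - a *: e_i)).
  have := weak_derivative_seval (box_strans (- (a *: e_i)) bs).
  have Es v : sderiv i (strans v s) = strans v (sderiv i s).
    by elim: (s) => //= [e1 -> e2 -> //|e1 -> e2 -> //].
  rewrite Es => H; rewrite -[RHS]opprK; congr (- _).
  transitivity (\int[leb]_x (u x * seval (strans (- (a *: e_i)) (sderiv i s)) x)).
    by apply: eq_Rintegral => x _; rewrite seval_strans.
  by rewrite H; congr (- _); apply: eq_Rintegral => x _; rewrite seval_strans.
rewrite -E.
apply: (@is_derive_shift_integral R n i u (seval s) (seval (sderiv i s))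
  (fun x => `|u x| * K x)) => //.
- exact: (rV_continuous_measurable (@continuous_seval R n (sderiv i s))).
- exact: is_derive_seval.
- move=> t; apply: (L2_mul Lu).
  exact: (L2_shift (- (t *: e_i)) (L2_seval bs)).
- exact: (L2_mul Lau LK).
- by move=> t x ta; rewrite normrM ler_wpM2l// sK.
Qed.

Lemma shift_seval_integral (s : sexpr R n) (t : R) :
  box_supported (seval s) ->
  \int[leb]_x (u x * seval s (x - t *: e_i)) =
  \int[leb]_x (u (x + t *: e_i) * seval s x).
Proof.
move=> bs; rewrite -(@Rintegral_shift R n (t *: e_i)).
  by apply: eq_Rintegral => x _; rewrite addrK.
apply: measurable_funM; first by case: Lu.
by apply: measurable_shift; case: (L2_seval bs).
Qed.

Let diff (h : R) (x : V) := u (x + h *: e_i) - u x.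

Let L2_diff h : L2 leb (diff h).
Proof. by apply: L2B => //; exact: L2_shift. Qed.

Let diff_seval h (s : sexpr R n) : box_supported (seval s) ->
  \int[leb]_x (diff h x * seval s x) =
  (\int[leb]_x (u x * seval s (x - h *: e_i))) -
  \int[leb]_x (u x * seval s (x - 0 *: e_i)).
Proof.
move=> bs; have Ls := L2_seval bs.
rewrite !shift_seval_integral// scale0r.
have -> : \int[leb]_x (u (x + 0) * seval s x) = \int[leb]_x (u x * seval s x).
  by apply: eq_Rintegral => x _; rewrite addr0.
rewrite -RintegralB//; last 2 first.
- exact: L2_mul (L2_shift _ Lu) Ls.
- exact: L2_mul Lu Ls.
by apply: eq_Rintegral => x _; rewrite /diff mulrBl.
Qed.

(** In place of a duality argument, the difference [d] is itself approximated by a test expression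
    [s]. The mean value theorem gives int d s = I h, where I is the integral of [g] against a
    translate of [s]; translation invariance and Cauchy-Schwarz bound I^2 by
    [nsq leb g * nsq leb (seval s)]. *)
Lemma nsq_shift_diff_le (h : R) : 0 <= h ->
  nsq leb (fun x => u (x + h *: e_i) - u x) <= h ^+ 2 * nsq leb g.
Proof.
move=> h0; apply/ler_addgt0Pr => e e0.
have [_ /(_ _ e0)[s [Ls bs dse]]] := approximable_L2 (L2_diff h).
have [c _ Hc] := @MVT_segment R
  (fun t => \int[leb]_x (u x * seval s (x - t *: e_i)))
  (fun t => \int[leb]_x (g x * seval s (x - t *: e_i))) 0 h h0
  (fun t _ => is_derive_shift_seval t bs)
  (derivable_within_continuous (fun t _ => @ex_derive _ _ _ _ _ _ _ (is_derive_shift_seval t bs))).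
rewrite -diff_seval// subr0 in Hc.
have Lsc : L2 leb (fun x => seval s (x - c *: e_i)) by exact: (L2_shift (- (c *: e_i)) Ls).
have := cauchy_schwarz Lg Lsc.
rewrite (nsq_shift (- (c *: e_i))); last by case: Ls.
set I := \int[leb]_x (g x * _) in Hc * => CS.
have expand : nsq leb (fun x => diff h x - seval s x) =
    nsq leb (diff h) - 2 * (I * h) + nsq leb (seval s).
  have [_ di] := L2_diff h; have [_ si] := Ls; have ids := L2_mul (L2_diff h) Ls.
  rewrite -Hc /nsq -RintegralZl// -RintegralB//; last exact: integrableZr.
  rewrite -RintegralD//; last by apply: integrableBr => //; exact: integrableZr.
  by apply: eq_Rintegral => x _; ring.
rewrite expand in dse.
have f0 := nsq_ge0 leb g; have s0 := nsq_ge0 leb (seval s).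
(* Expanding the error, nsq d - 2 I h + nsq s <= e. The claim, an arithmetic-geometric mean
   inequality, makes nsq s cancel and leaves exactly h^2 nsq g + e. *)
suff : 2 * (I * h) <= h ^+ 2 * nsq leb g + nsq leb (seval s).
  by move: dse; rewrite /diff; lra.
apply: le_trans (ler_norm _) _.
have A0 : 0 <= h ^+ 2 * nsq leb g by rewrite mulr_ge0// sqr_ge0.
rewrite -(@ler_pXn2r _ 2)// ?nnegrE ?addr_ge0// real_normK ?num_real//.
have : (I * h) ^+ 2 <= h ^+ 2 * nsq leb g * nsq leb (seval s).
  by rewrite exprMn mulrC -mulrA ler_wpM2l ?sqr_ge0.
have := sqr_ge0 (h ^+ 2 * nsq leb g - nsq leb (seval s)).
lra.
Qed.

Lemma cvg_derive_harmonic (f : R -> R) (l : R) : is_derive (0 : R) 1 f l ->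
  k.+1%:R * (f k.+1%:R^-1 - f 0) @[k --> \oo] --> l.
Proof.
move=> [df fl].
have fl' : (fun h : R => h^-1 *: ((f \o shift 0) (h *: 1) - f 0)) @ (0:R)^' --> l.
  by rewrite -fl; exact: df.
have := (cvgr_dnbhsP _ _ _).1 fl' (fun k => k.+1%:R^-1).
move=> H; apply: cvg_trans (H (conj _ _)).
- apply: near_eq_cvg; apply: nearW => k /=.
  by rewrite invrK addr0 /GRing.scale/= mulr1.
- by move=> k; rewrite invr_eq0.
- exact: cvg_harmonic.
Qed.

(** Convergence holds against test expressions by differentiation at 0; it extends to all of L^2
    because the quotients are bounded in L^2 by [nsq_shift_diff_le] and the expressions are
    dense. *)
Lemma shift_quotient_weak_cvg (v : V -> R) : L2 leb v ->
  k.+1%:R * \int[leb]_x (diff k.+1%:R^-1 x * v x) @[k --> \oo] -->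
    \int[leb]_x (g x * v x).
Proof.
move=> Lv; apply/cvgrPdist_le => e e0.
have g0 := nsq_ge0 leb g.
(* Below, the error [D] satisfies [nsq leb D <= 4 * nsq leb g + 1], so approximating [v] to this
   accuracy costs at most [e / 2] by Cauchy-Schwarz. *)
have d0 : 0 < (e / 2) ^+ 2 / (4 * nsq leb g + 1).
  by rewrite divr_gt0 ?exprn_gt0 ?divr_gt0//; lra.
have [_ /(_ _ d0)[s [Ls bs vs]]] := approximable_L2 Lv.
have e20 : 0 < e / 2 by rewrite divr_gt0.
have /cvgrPdist_le /(_ _ e20) :=
  cvg_derive_harmonic (is_derive_shift_seval 0 bs).
have -> : \int[leb]_x (g x * seval s (x - 0 *: e_i)) = \int[leb]_x (g x * seval s x).
  by apply: eq_Rintegral => x _; rewrite scale0r subr0.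
move=> near_s; near=> k.
have : `|\int[leb]_x (g x * seval s x) -
    k.+1%:R * \int[leb]_x (diff k.+1%:R^-1 x * seval s x)| <= e / 2.
  by rewrite diff_seval//; near: k.
set h := k.+1%:R^-1; set D := fun x => g x - k.+1%:R * diff h x.
have LD : L2 leb D by apply: L2B => //; exact: L2Z.
have split_int w : L2 leb w -> \int[leb]_x (g x * w x) -
    k.+1%:R * \int[leb]_x (diff h x * w x) = \int[leb]_x (D x * w x).
  move=> Lw; have iDw := L2_mul (L2_diff h) Lw.
  rewrite -RintegralZl// -RintegralB//; [|exact: L2_mul|exact: integrableZr].
  by apply: eq_Rintegral => x _; rewrite /D; ring.
rewrite !split_int// => Hs.
have -> : \int[leb]_x (D x * v x) =
    \int[leb]_x (D x * seval s x) + \int[leb]_x (D x * (v x - seval s x)).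
  rewrite -RintegralD//; [|exact: L2_mul|by apply: L2_mul => //; exact: L2B].
  by apply: eq_Rintegral => x _; ring.
apply: le_trans (ler_normD _ _) _.
suff : `|\int[leb]_x (D x * (v x - seval s x))| <= e / 2 by lra.
rewrite -(@ler_pXn2r _ 2)// ?nnegrE ?(ltW e20)// real_normK ?num_real//.
apply: le_trans (cauchy_schwarz LD (L2B Lv Ls)) _.
have ND : nsq leb D <= 4 * nsq leb g + 1.
  rewrite /D (_ : (fun x => _) = (fun x => g x + (- k.+1%:R) * diff h x)); last first.
    by apply/funext => x; rewrite mulNr.
  apply: le_trans (nsqD_le Lg (L2Z _ (L2_diff h))) _.
  rewrite nsqZ// sqrrN.
  have h0 : 0 <= h by rewrite invr_ge0.
  have := ler_wpM2l (sqr_ge0 (k.+1%:R : R)) (nsq_shift_diff_le h0).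
  rewrite mulrA -exprMn /h divff// expr1n mul1r /diff; lra.
rewrite (le_trans (ler_pM _ _ ND vs)) ?nsq_ge0//.
by rewrite mulrC divfK//; lra.
Unshelve. all: by end_near. Qed.

(** With d the increment of [u], one has u(x + h e_i)^2 - u(x)^2 = 2 u d + d^2. Divided by h and
    integrated against [F], the first term converges by weak convergence tested on 2 u F, which is
    in L^2 as [F] is bounded; the second is of order h. Shifting [F] instead gives the other
    expression of the same limit. *)
Lemma weak_square_rule (F F' : V -> R) (M M' : R) :
  measurable_fun setT F -> measurable_fun setT F' ->
  (forall x, is_derive x e_i F (F' x)) ->
  (forall x, `|F x| <= M) -> (forall x, `|F' x| <= M') ->
  \int[leb]_x (u x ^+ 2 * F' x) = - (2 * \int[leb]_x (g x * (u x * F x))).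
Proof.
move=> mF mF' dF FM F'M; have [mu_ iu] := Lu.
have M0 : 0 <= M by apply: le_trans (FM 0); exact: normr_ge0.
have iuF (f : V -> R) C : measurable_fun setT f -> (forall x, `|f x| <= C) ->
    leb.-integrable setT (EFin \o (fun x => u x ^+ 2 * f x)).
  move=> mf fC; apply: integrable_dominated (integrableZr C iu).
    by apply: measurable_funM => //; exact: measurable_funX.
  by move=> x; rewrite normrM mulrC [`|_ ^+ 2|]ger0_norm ?sqr_ge0// ler_wpM2r ?sqr_ge0.
have dP := @is_derive_shift_integral R n i (fun x => u x ^+ 2) F F'
  (fun x => M' * u x ^+ 2) 0.
have {dP} /cvg_derive_harmonic H : is_derive (0:R) 1
    (fun t => \int[leb]_x (u x ^+ 2 * F (x - t *: e_i)))
    (- \int[leb]_x (u x ^+ 2 * F' (x - 0 *: e_i))).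
  apply: dP => //.
  - exact: measurable_funX.
  - move=> t; apply: (iuF _ M); first exact: measurable_shift.
    by move=> x; exact: FM.
  - exact: integrableZr.
  - by move=> t x _; rewrite normrM mulrC [`|_ ^+ 2|]ger0_norm ?sqr_ge0// ler_wpM2r ?sqr_ge0.
have LuF : L2 leb (fun x => u x * F x).
  by under eq_fun do rewrite mulrC; exact: (L2_bounded_mul mF FM).
have H2 : k.+1%:R * \int[leb]_x (diff k.+1%:R^-1 x * (2 * (u x * F x)))
    @[k --> \oo] --> \int[leb]_x (g x * (2 * (u x * F x))).
  by apply: shift_quotient_weak_cvg; exact: L2Z.
have LdF h : L2 leb (fun x => F x * diff h x) by exact: (L2_bounded_mul mF FM).
(* The quadratic remainder is at most M h^2 [nsq leb g], hence at most h M [nsq leb g] after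
   multiplication by [k.+1] = 1 / h. *)
have H3 : k.+1%:R * \int[leb]_x (diff k.+1%:R^-1 x * (F x * diff k.+1%:R^-1 x))
    @[k --> \oo] --> (0 : R).
  apply/cvgr0Pnorm_le => e e0.
  have Mg : 0 <= M * nsq leb g by rewrite mulr_ge0// nsq_ge0.
  have Mg1 : 0 < M * nsq leb g + 1 by lra.
  near=> k; set h := k.+1%:R^-1.
  have h0 : 0 <= h by rewrite invr_ge0.
  rewrite normrM ger0_norm//.
  have : `|\int[leb]_x (diff h x * (F x * diff h x))| <= M * (h ^+ 2 * nsq leb g).
    apply: le_trans (le_normr_Rintegral _ (L2_mul (L2_diff h) (LdF h))) _ => //.
    apply: le_trans (ler_wpM2l M0 (nsq_shift_diff_le h0)).
    have [md di] := L2_diff h.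
    rewrite /nsq -RintegralZl//; apply: le_Rintegral => //.
    + by apply: integrable_norm; exact: (L2_mul (L2_diff h) (LdF h)).
    + exact: integrableZr.
    + move=> x _; rewrite (_ : diff h x * _ = F x * diff h x ^+ 2); last by ring.
      by rewrite normrM [`|_ ^+ 2|]ger0_norm ?sqr_ge0// ler_wpM2r ?sqr_ge0.
  move=> /(ler_wpM2l (ler0n R k.+1)) /le_trans; apply.
  have -> : k.+1%:R * (M * (h ^+ 2 * nsq leb g)) = h * (M * nsq leb g).
    have kh : k.+1%:R * h = 1 by rewrite divff.
    transitivity ((k.+1%:R * h) * (h * (M * nsq leb g))); first by ring.
    by rewrite kh mul1r.
  have hs : k.+1%:R^-1 < e / (M * nsq leb g + 1).
    near: k; exact: (near_infty_natSinv_lt (PosNum (divr_gt0 e0 Mg1))).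
  move: hs; rewrite -/h ltr_pdivlMr//; nra.
have : k.+1%:R * (\int[leb]_x (u x ^+ 2 * F (x - k.+1%:R^-1 *: e_i)) -
      \int[leb]_x (u x ^+ 2 * F (x - 0 *: e_i))) @[k --> \oo] -->
    \int[leb]_x (g x * (2 * (u x * F x))) + 0.
  apply: cvg_trans (cvgD H2 H3); apply: near_eq_cvg; apply: nearW => k.
  set h := k.+1%:R^-1.
  transitivity (k.+1%:R * (\int[leb]_x (diff h x * (2 * (u x * F x))) +
    \int[leb]_x (diff h x * (F x * diff h x)))); first by rewrite mulrDr.
  congr (_ * _).
  have -> : \int[leb]_x (u x ^+ 2 * F (x - h *: e_i)) =
      \int[leb]_x (u (x + h *: e_i) ^+ 2 * F x).
    rewrite -(@Rintegral_shift R n (h *: e_i)).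
      by apply: eq_Rintegral => x _; rewrite addrK.
    apply: measurable_funM; first exact: measurable_funX.
    exact: measurable_shift.
  rewrite -RintegralD//; [|by apply: L2_mul => //; exact: L2Z|exact: L2_mul].
  rewrite -RintegralB//.
  - by apply: eq_Rintegral => x _; rewrite /diff scale0r subr0; ring.
  - rewrite (_ : (fun x => _) = (fun x =>
        (fun y => u y ^+ 2 * F (y - h *: e_i)) (x + h *: e_i))); last first.
      by apply/funext => x; rewrite addrK.
    apply: (@integrable_shift R n (h *: e_i)
      (EFin \o (fun y => u y ^+ 2 * F (y - h *: e_i)))).
    apply: (iuF _ M); first exact: measurable_shift.
    by move=> x; exact: FM.
  - apply: (iuF _ M); first exact: measurable_shift.
    by move=> x; exact: FM.
move=> H'; have := cvg_unique (@norm_hausdorff _ _) H H'.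
rewrite addr0 => E.
have -> : \int[leb]_x (u x ^+ 2 * F' x) = \int[leb]_x (u x ^+ 2 * F' (x - 0 *: e_i)).
  by apply: eq_Rintegral => x _; rewrite scale0r subr0.
rewrite -[LHS]opprK E; congr (- _); rewrite -RintegralZl//; last exact: L2_mul.
by apply: eq_Rintegral => x _; ring.
Unshelve. all: by end_near. Qed.

End weak_derivative.

(** * Hardy's inequality and the lower bound *)

(** This polynomial is [sqnorm] along a coordinate line, up to its constant term ([sqnorm_line]). *)
Lemma is_derive_quadratic (R : realType) (q b : R) :
  is_derive (0 : R) (1 : R) (fun t : R => q + (2 * b * t + t ^+ 2)) (2 * b).
Proof.
rewrite (_ : (fun t => _) = cst q + ((2 * b) \*: @id R + (@id R) ^+ 2)); last first.
  by apply/funext => t; rewrite !fctE.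
have d1 : is_derive (0 : R) (1 : R) (@id R) (1 : R) by exact: is_derive_id.
have d2 := is_deriveD (is_deriveZ (2 * b) d1) (is_deriveX 2 d1).
have d3 : is_derive (0 : R) (1 : R) (cst q : R -> R) (0 : R) by exact: is_derive_cst.
apply: (is_derive_eq (is_deriveD d3 d2)); rewrite /GRing.scale/=; ring.
Qed.

Section hardy.
Context (R : realType) (n : nat).
Local Notation V := 'rV[R]_n.
Local Notation leb := (lebesgueN R n).

Lemma sqnorm_ge0 (x : V) : 0 <= sqnorm x.
Proof. by apply: sumr_ge0 => i _; exact: sqr_ge0. Qed.

Lemma sqr_coord_le_sqnorm (x : V) i : x ord0 i ^+ 2 <= sqnorm x.
Proof. by rewrite /sqnorm (bigD1 i)//= lerDl sumr_ge0// => j _; exact: sqr_ge0. Qed.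

Lemma sqnorm_line (x : V) i (t : R) :
  sqnorm (t *: delta_mx ord0 i + x) = sqnorm x + (2 * x ord0 i * t + t ^+ 2).
Proof.
rewrite /sqnorm (bigD1 i)//= [in RHS](bigD1 i)//= !mxE !eqxx mulr1.
under eq_bigr => j ji do rewrite !mxE (negbTE ji) andbF mulr0 add0r.
by ring.
Qed.

Lemma measurable_sqnorm : measurable_fun [set: V] (@sqnorm R n).
Proof.
apply: measurable_sum => i; apply: measurable_funX; exact: measurable_coord.
Qed.

Lemma measurable_inv_ge0 d (T : measurableType d) (f : T -> R) :
  (forall x, 0 <= f x) -> measurable_fun setT f ->
  measurable_fun setT (fun x => (f x)^-1).
Proof.
move=> f0 mf; under eq_fun do rewrite -powR_inv1//.
by apply: (measurableT_comp (measurable_powR _)).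
Qed.

Variable a : R.
Hypothesis a0 : 0 < a.

Let s (x : V) := a + sqnorm x.
Let s_gt0 x : 0 < s x. Proof. by rewrite ltr_pwDl// sqnorm_ge0. Qed.
Let F i (x : V) := x ord0 i / s x.
Let F' i (x : V) := (s x)^-1 - 2 * x ord0 i ^+ 2 / s x ^+ 2.

Let is_derive_F i x : is_derive x (delta_mx ord0 i : V) (F i) (F' i x).
Proof.
apply/is_derive_lineP.
pose b := x ord0 i; pose q := s x.
have dN : is_derive (0:R) (1:R) (fun t : R => t + b) 1.
  rewrite (_ : (fun t => t + b) = @id R + cst b)//.
  by apply: is_derive_eq; rewrite addr0.
have dD := is_derive_quadratic q b.
have q0 : q + (2 * b * 0 + 0 ^+ 2) = q by ring.
have qn0 : q + (2 * b * 0 + 0 ^+ 2) != 0 by rewrite q0 gt_eqF// /q s_gt0.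
have dV := @is_deriveV R (fun t : R => q + (2 * b * t + t ^+ 2)) 0 _ _ qn0 dD.
rewrite (_ : (fun t : R => _) = (fun t => t + b) * (fun t => (q + (2 * b * t + t ^+ 2))^-1)).
  apply: is_derive_eq; rewrite /GRing.scale/= q0 /F' -/q -/b; field.
  by rewrite gt_eqF// /q s_gt0.
apply/funext => t; rewrite /F /s sqnorm_line mulrfctE !mxE !eqxx mulr1.
by rewrite /q /s -addrA.
Qed.

Let ms : measurable_fun setT (fun x => (s x)^-1).
Proof.
apply: measurable_inv_ge0 => [x|]; first exact: ltW.
by apply: measurable_funD => //; exact: measurable_sqnorm.
Qed.

Let mF i : measurable_fun setT (F i).
Proof. by apply: measurable_funM => //; exact: measurable_coord. Qed.

Let mF' i : measurable_fun setT (F' i).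
Proof.
apply: measurable_funB => //; under eq_fun do rewrite -exprVn.
apply: measurable_funM; last exact: measurable_funX.
apply: measurable_funM => //; apply: measurable_funX; exact: measurable_coord.
Qed.

Let coord_le i (x : V) : x ord0 i ^+ 2 / s x <= 1.
Proof.
rewrite ler_pdivrMr// mul1r (le_trans (sqr_coord_le_sqnorm x i))// lerDr ltW//.
Qed.

Let s_inv_le (x : V) : (s x)^-1 <= a^-1.
Proof. by rewrite lef_pV2 ?posrE// lerDl sqnorm_ge0. Qed.

Let FM i (x : V) : `|F i x| <= a^-1 + 1.
Proof.
rewrite normrM [`|(s x)^-1|]gtr0_norm ?invr_gt0//.
have := coord_le i x; have := s_inv_le x.
have : `|x ord0 i| <= 1 + x ord0 i ^+ 2.
  by rewrite -[X in _ + X]real_normK ?num_real//; have := sqr_ge0 (`|x ord0 i| - 1); have := normr_ge0 (x ord0 i); nra.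
have si : 0 < (s x)^-1 by rewrite invr_gt0.
move=> /(ler_wpM2r (ltW si)); lra.
Qed.

Let F'M i (x : V) : `|F' i x| <= 3 * a^-1.
Proof.
have si : 0 < (s x)^-1 by rewrite invr_gt0.
have h := coord_le i x; have h' := s_inv_le x.
have h0 : 0 <= x ord0 i ^+ 2 / s x by rewrite mulr_ge0 ?sqr_ge0// ltW.
have E : F' i x = (s x)^-1 - 2 * (x ord0 i ^+ 2 / s x) * (s x)^-1.
  by rewrite /F'; field; rewrite gt_eqF.
rewrite E; have := ler_wpM2r (ltW si) h; have := mulr_ge0 h0 (ltW si).
by rewrite ler_norml => ? ?; apply/andP; split; lra.
Qed.

Lemma regularized_hardy (u : V -> R) (g : 'I_n -> V -> R) : (2 < n)%N ->
  L2 leb u -> L2_weak_gradient u g ->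
  (n%:R - 2) ^+ 2 / 4 * \int[leb]_x (u x ^+ 2 / s x) <=
  \sum_(i < n) nsq leb (g i).
Proof.
move=> n2 Lu wg; have [mu_ iu] := Lu.
have Lg i : L2 leb (g i) by apply/Lfun_L2; case: (wg i).
pose c : R := n%:R - 2.
have c0 : 0 < c by rewrite subr_gt0 ltr_nat.
have rule i := weak_square_rule Lu (Lg i) (wg i).2 (mF i) (mF' i) (@is_derive_F i)
  (FM i) (F'M i).
have iw (h : V -> R) M : measurable_fun setT h -> (forall x, `|h x| <= M) ->
    leb.-integrable setT (EFin \o (fun x => u x ^+ 2 * h x)).
  move=> mh hM; apply: integrable_dominated (integrableZr M iu).
    by apply: measurable_funM => //; exact: measurable_funX.
  move=> x; rewrite normrM mulrC [`|_ ^+ 2|]ger0_norm ?sqr_ge0//.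
  by rewrite ler_wpM2r ?sqr_ge0.
have iws : leb.-integrable setT (EFin \o (fun x => u x ^+ 2 / s x)).
  apply: (iw _ a^-1) => // x; rewrite gtr0_norm ?invr_gt0//.
have LuF i : L2 leb (fun x => u x * F i x).
  by under eq_fun do rewrite mulrC; exact: (L2_bounded_mul (mF i) (FM i)).
have step1 : c * \int[leb]_x (u x ^+ 2 / s x) <=
    \sum_(i < n) \int[leb]_x (u x ^+ 2 * F' i x).
  rewrite -RintegralZl// -Rintegral_sum; last by move=> i; exact: iw (F'M i).
  apply: le_Rintegral => //.
  - exact: integrableZr.
  - by apply: integrable_sumr => i; exact: iw (F'M i).
  - move=> x _; rewrite -mulr_sumr mulrCA ler_wpM2l ?sqr_ge0//.
    rewrite /F' sumrB sumr_const card_ord -mulr_suml -mulr_sumr -/(sqnorm x).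
    have si : 0 < (s x)^-1 by rewrite invr_gt0.
    have -> : 2 * sqnorm x / s x ^+ 2 = 2 * (sqnorm x / s x) * (s x)^-1.
      by field; rewrite gt_eqF.
    rewrite -[(s x)^-1 *+ n]mulr_natl /c mulrBl lerD2l lerN2 ler_wpM2r ?(ltW si)//.
    rewrite -[leRHS]mulr1 ler_wpM2l// ler_pdivrMr// mul1r /s lerDr ltW//.
(* Young's inequality with weight c / 2, the one that maximises t (c - t): half of c I is absorbed
   on the left, and c^2 / 4 is the constant that results. The difference of the two sides is a
   perfect square. *)
have step2 i : \int[leb]_x (u x ^+ 2 * F' i x) <=
    2 / c * nsq leb (g i) + c / 2 * \int[leb]_x (u x ^+ 2 * F i x ^+ 2).
  have [mg ig] := Lg i; have [_ iuF] := LuF i.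
  have iuF2 : leb.-integrable setT (EFin \o (fun x => u x ^+ 2 * F i x ^+ 2)).
    by under eq_fun do rewrite -exprMn.
  rewrite rule -mulNr; have igF := L2_mul (Lg i) (LuF i).
  rewrite /nsq -[X in X <= _]RintegralZl// -!RintegralZl//.
  rewrite -RintegralD//; [|exact: integrableZr|exact: integrableZr].
  apply: le_Rintegral => //.
  - by apply: integrableZr; exact: (L2_mul (Lg i) (LuF i)).
  - by apply: integrableDr; exact: integrableZr.
  - move=> x _; rewrite -subr_ge0.
    rewrite (_ : _ - _ = c / 2 * (2 / c * g i x + u x * F i x) ^+ 2); last by field; rewrite gt_eqF.
    by rewrite mulr_ge0 ?sqr_ge0// divr_ge0 ?ltW.
have step3 : \sum_(i < n) \int[leb]_x (u x ^+ 2 * F i x ^+ 2) <= \int[leb]_x (u x ^+ 2 / s x).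
  have iuF2 i : leb.-integrable setT (EFin \o (fun x => u x ^+ 2 * F i x ^+ 2)).
    by have [_] := LuF i; under eq_fun do rewrite exprMn.
  rewrite -Rintegral_sum//; apply: le_Rintegral => //; first exact: integrable_sumr.
  move=> x _; rewrite -mulr_sumr ler_wpM2l ?sqr_ge0//.
  under eq_bigr do rewrite /F exprMn; rewrite -mulr_suml -/(sqnorm x) exprVn.
  have si : 0 < (s x)^-1 by rewrite invr_gt0.
  have -> : sqnorm x / s x ^+ 2 = (sqnorm x / s x) * (s x)^-1.
    by field; rewrite gt_eqF.
  rewrite -[leRHS]mul1r ler_wpM2r ?(ltW si)// ler_pdivrMr// mul1r /s lerDr ltW//.
set I := \int[leb]_x (u x ^+ 2 / s x) in step1 step3 *.
have : c * I <= 2 / c * \sum_(i < n) nsq leb (g i) + c / 2 * I.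
  apply: le_trans step1 _; apply: (le_trans (ler_sum _ (fun i _ => step2 i))).
  rewrite big_split/= -!mulr_sumr lerD2l ler_wpM2l// divr_ge0// ltW//.
rewrite -/c => H.
rewrite -(@ler_pM2l _ (2 / c)) ?divr_gt0//.
apply: le_trans (_ : c / 2 * I <= _); last by lra.
by rewrite le_eqVlt; apply/orP; left; apply/eqP; field; rewrite gt_eqF.
Qed.

End hardy.

Section lower_bound.
Context (R : realType) (n : nat).
Local Notation V := 'rV[R]_n.
Local Notation leb := (lebesgueN R n).

Lemma H1_energyE (u : V -> R) (g : 'I_n -> V -> R) :
  L2 leb u -> (forall i, L2 leb (g i)) ->
  H1_energy u g = (\sum_(i < n) nsq leb (g i) + nsq leb u)%:E.
Proof.
move=> [mu_ iu] Lg.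
have ig i : leb.-integrable setT (EFin \o (fun x => g i x ^+ 2)) by case: (Lg i).
rewrite /H1_energy -EFin_Rintegral; last exact: integrableDr (integrable_sumr _ ig) iu.
by rewrite RintegralD//; [rewrite Rintegral_sum|exact: integrable_sumr].
Qed.

Lemma nsq_gt0 (u : V -> R) : L2 leb u -> ~ u = \0 %[ae leb] -> 0 < nsq leb u.
Proof.
move=> [mu_ iu] u0; rewrite lt_def nsq_ge0 andbT; apply: contra_notN u0 => /eqP N0.
have : (\int[leb]_x `|(u x ^+ 2)%:E| = 0)%E.
  under eq_integral do rewrite gee0_abs ?lee_fin ?sqr_ge0//.
  by rewrite -EFin_Rintegral// -/(nsq leb u) N0.
move=> /ae_eq_integral_abs -/(_ measurableT); case.
  by apply/measurable_EFinP; exact: measurable_funX.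
move=> N [mN N0' sub]; exists N; split => // x /= H; apply: sub => /= H'.
by apply: H => _; have := H' I => -[/eqP]; rewrite sqrf_eq0 => /eqP.
Qed.

(** The inequality is between extended reals because finiteness of the weighted integral is part of
    the conclusion: for [nu = 0] the weight is unbounded. *)
Lemma hardy (nu : R) (u : V -> R) (g : 'I_n -> V -> R) : (2 < n)%N ->
  L2 leb u -> L2_weak_gradient u g ->
  (weighted_L2 nu u <= (4 / (n%:R - 2) ^+ 2 * \sum_(i < n) nsq leb (g i))%:E)%E.
Proof.
move=> n2 Lu wg; have [mu_ iu] := Lu.
pose s (x : V) := nu ^+ 2 + sqnorm x.
have s0 x : 0 <= s x by rewrite addr_ge0 ?sqr_ge0 ?sqnorm_ge0.
have ms : measurable_fun setT s by apply: measurable_funD => //; exact: measurable_sqnorm.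
have mV (h : V -> R) : (forall x, 0 <= h x) -> measurable_fun setT h ->
  measurable_fun setT (fun x => (h x)^-1) by exact: measurable_inv_ge0.
(* The factor [s x / s x] vanishes where [1 / s x] takes its junk value, so
   that [f k] tends to the weighted integrand everywhere. *)
pose f k x := u x ^+ 2 * ((s x / s x) / (s x + k.+1%:R^-1)).
have sk0 k x : 0 < s x + k.+1%:R^-1 by rewrite ltr_wpDl// invr_gt0.
have mf k : measurable_fun setT (f k).
  apply: measurable_funM; first exact: measurable_funX.
  apply: measurable_funM; first by apply: measurable_funM => //; exact: mV.
  by apply: mV => [x|]; [exact: ltW|exact: measurable_funD].
have f0 k x : 0 <= f k x by rewrite mulr_ge0 ?sqr_ge0// mulr_ge0 ?invr_ge0 ?(ltW (sk0 _ _))// divr_ge0.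
have ff x : f k x @[k --> \oo] --> u x ^+ 2 / s x.
  have [sx|sx] := eqVneq (s x) 0.
    rewrite sx invr0 mulr0 (_ : (fun k => _) = cst 0); first exact: cvg_cst.
    by apply/funext => k; rewrite /f sx mul0r mul0r mulr0.
  apply: cvgM; first exact: cvg_cst.
  under eq_fun do rewrite divff// mul1r.
  apply: cvgV => //; rewrite -[X in _ --> X]addr0; apply: cvgD; first exact: cvg_cst.
  exact: cvg_harmonic.
pose C := 4 / (n%:R - 2) ^+ 2 * \sum_(i < n) nsq leb (g i).
have fC k : (\int[leb]_x (f k x)%:E <= C%:E)%E.
  (* This is the regularisation parameter, positive even when [nu] vanishes. *)
  have k0 : 0 < nu ^+ 2 + k.+1%:R^-1 by rewrite ltr_wpDl ?sqr_ge0// invr_gt0.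
  pose w x := u x ^+ 2 / (nu ^+ 2 + k.+1%:R^-1 + sqnorm x).
  have sE x : nu ^+ 2 + k.+1%:R^-1 + sqnorm x = s x + k.+1%:R^-1.
    by rewrite /s addrAC.
  have iw : leb.-integrable setT (EFin \o w).
    apply: integrable_dominated (integrableZr (nu ^+ 2 + k.+1%:R^-1)^-1 iu).
      apply: measurable_funM; first exact: measurable_funX.
      under eq_fun do rewrite sE.
      by apply: mV => [x|]; [exact: ltW|exact: measurable_funD].
    move=> x; rewrite /w ger0_norm; last by rewrite mulr_ge0 ?sqr_ge0// invr_ge0 sE ltW.
    rewrite mulrC ler_wpM2r ?sqr_ge0// lef_pV2 ?posrE ?sE//.
    by rewrite -sE lerDl sqnorm_ge0.
  apply: (@le_trans _ _ (\int[leb]_x (w x)%:E)%E).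
    apply: ge0_le_integral => //.
    - by move=> x _; rewrite lee_fin.
    - exact/measurable_EFinP.
    - exact: (measurable_int _ iw).
    - move=> x _; rewrite lee_fin /f /w ler_wpM2l ?sqr_ge0// sE ler_piMl//.
        by rewrite invr_ge0 ltW.
      by have [->|sx] := eqVneq (s x) 0; rewrite ?mul0r// divff.
  rewrite -EFin_Rintegral// lee_fin /C.
  have n20 : 0 < (n%:R - 2) ^+ 2 :> R by rewrite exprn_gt0// subr_gt0 ltr_nat.
  have := regularized_hardy k0 n2 Lu wg.
  move=> /(ler_wpM2l (_ : 0 <= 4 / (n%:R - 2) ^+ 2)) H.
  apply: le_trans (H _); last by rewrite divr_ge0// ltW.
  by rewrite mulrA -[X in X * _ * _]invf_div mulVf ?mul1r// gt_eqF// divr_gt0.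
rewrite /weighted_L2.
rewrite (eq_integral (fun x => limn_einf (fun k => (f k x)%:E))); last first.
  move=> x _; apply/esym; apply: (cvg_limn_einf_sup _).1.
  apply: cvg_EFin; first by apply: nearW.
  exact: (ff x).
apply: (le_trans (fatou _ measurableT (fun k => (measurable_EFinP _ _).2 (mf k)) _)).
  by move=> k x _; rewrite lee_fin.
rewrite limn_einf_lim; apply: lime_le; first exact: is_cvg_einfs.
apply: nearW => k; apply: le_trans (fC k); apply: ereal_inf_lbound.
by exists k => /=.
Qed.

Lemma best_constant_ge (nu : R) : (2 < n)%N ->
  (((n%:R - 2) ^+ 2 / 4)%:E <= best_constant n nu)%E.
Proof.
move=> n2; apply: le_ereal_inf_tmp => _ [u [g [[/Lfun_L2 Lu _] u0 wg ->]]].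
have Lg i : L2 leb (g i) by apply/Lfun_L2; case: (wg i).
rewrite H1_energyE//; have := hardy nu n2 Lu wg.
have u20 := nsq_gt0 Lu u0.
have g0 : 0 <= \sum_(i < n) nsq leb (g i) by apply: sumr_ge0 => i _; exact: nsq_ge0.
have W0 : (0 <= weighted_L2 nu u)%E.
  apply: integral_ge0 => x _; rewrite lee_fin divr_ge0 ?sqr_ge0//.
  by rewrite addr_ge0 ?sqr_ge0 ?sqnorm_ge0.
have n20 : 0 < (n%:R - 2) ^+ 2 :> R by rewrite exprn_gt0// subr_gt0 ltr_nat.
case: (weighted_L2 nu u) W0 => [w||]//; rewrite !lee_fin => w0 wC.
(* The extended inverse of 0 is +oo, so a vanishing weighted integral gives the quotient +oo, the
   energy being positive. An infinite weighted integral was excluded by [hardy]. *)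
rewrite inver; case: ifPn => [_|wn0]; first by rewrite gt0_muley ?leey// lte_fin; lra.
have wp : 0 < w by rewrite lt_def wn0.
rewrite -EFinM lee_fin ler_pdivlMr//.
have := ler_wpM2l (_ : 0 <= (n%:R - 2) ^+ 2 / 4) wC; rewrite divr_ge0 ?(ltW n20)//.
move=> /(_ isT) /le_trans; apply; rewrite mulrA -[X in _ * X * _]invf_div divff; last by rewrite gt_eqF// divr_gt0.
by rewrite mul1r lerDl ltW.
Qed.

End lower_bound.

(** * Gaussian functions and the upper bound *)

Section gaussian.
Context (R : realType).

Lemma sqnorm_cons n (p : R * 'rV[R]_n) :
  sqnorm (rV_cons p) = p.1 ^+ 2 + sqnorm p.2.
Proof.
rewrite /sqnorm big_ord_recl rV_cons0; congr (_ + _).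
by apply: eq_bigr => j _; rewrite rV_consS.
Qed.

Lemma integral_lebesgueN_succ n (f : 'rV[R]_n.+1 -> \bar R) :
  measurable_fun setT f -> (forall x, 0 <= f x)%E ->
  (\int[lebesgueN R n.+1]_x f x =
   \int[lebesgue_measure]_t \int[lebesgueN R n]_y f (rV_cons (t, y)))%E.
Proof.
move=> mf f0; have mc := @measurable_rV_cons R n.
pose m : {measure set (measurableTypeR R * 'rV[R]_n) -> \bar R} :=
  (lebesgue_measure \x lebesgueN R n)%E.
have := @ge0_integral_pushforward _ _ (measurableTypeR R * 'rV[R]_n)%type
  'rV[R]_n.+1 R (@rV_cons R n) mc m setT f measurableT mf (fun x _ => f0 x).
rewrite preimage_setT => E.
apply: etrans (etrans _ E) _; first exact: eq_measure_integral.
apply: (@fubini_tonelli1 _ _ (measurableTypeR R) 'rV[R]_n R lebesgue_measure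
  (lebesgueN R n) (f \o @rV_cons R n)).
  exact: measurableT_comp mf mc.
by move=> x; exact: f0.
Qed.

Lemma measurable_gaussian n (c : R) :
  measurable_fun setT (fun x : 'rV[R]_n => expR (- (c * sqnorm x))).
Proof.
apply: measurableT_comp => //; apply: measurable_funN.
by apply: measurable_funM => //; exact: measurable_sqnorm.
Qed.

(** By Tonelli, the integral is that of the one-dimensional Gaussian times the integral in one
    dimension less. *)
Lemma integrable_gaussian n :
  (lebesgueN R n).-integrable setT (EFin \o (fun x => expR (- sqnorm x))).
Proof.
have m m' : measurable_fun setT (EFin \o (fun x : 'rV[R]_m' => expR (- sqnorm x))).
  by apply/measurable_EFinP; have := @measurable_gaussian m' 1; under eq_fun do rewrite mul1r.
elim: n => [|n IHn]; apply/integrableP; split; do ?exact: m.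
  rewrite (eq_integral (cst 1%E)); last first.
    by move=> x _; rewrite /= /sqnorm big_ord0 oppr0 expR0 normr1.
  by rewrite integral_cst//= mul1e diracE ltry.
rewrite (eq_integral (EFin \o (fun x => expR (- sqnorm x)))); last first.
  by move=> x _; rewrite /= ger0_norm ?expR_ge0.
rewrite integral_lebesgueN_succ; [|exact: m|by move=> x; rewrite lee_fin expR_ge0].
pose c := (\int[lebesgueN R n]_y (expR (- sqnorm y))%:E)%E.
have c0 : (0 <= c)%E by apply: integral_ge0 => y _; rewrite lee_fin expR_ge0.
have cfin : (c < +oo)%E by exact: integrable_lty IHn.
have mG : measurable_fun setT (EFin \o @gauss_fun R).
  by apply/measurable_EFinP; exact: measurable_gauss_fun.
have -> : (fun t : R => \int[lebesgueN R n]_y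
    (EFin \o (fun x => expR (- sqnorm x))) (rV_cons (t, y)))%E =
    (fun t : R => (c * (gauss_fun t)%:E)%E).
  apply/funext => t; rewrite muleC /c -(ge0_integralZl (lebesgueN R n) measurableT (m n)); last 2 first.
  - by move=> y _; rewrite lee_fin expR_ge0.
  - by rewrite lee_fin expR_ge0.
  by apply: eq_integral => y _; rewrite /= sqnorm_cons /= opprD expRD.
rewrite (ge0_integralZl lebesgue_measure measurableT mG)//; last first.
  by move=> t _; rewrite lee_fin expR_ge0.
rewrite lte_mul_pinfty ?ge0_fin_numE//.
by apply: integrable_lty => //; exact: integrableT_gauss.
Qed.

End gaussian.

(** For [nu = 0] the weight takes the formal value 0 at the origin, where the tangent-line bound
    used for Jensen's inequality fails. The exceptional set is a whole coordinate hyperplane, whose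
    measure is computed by slices. *)
Lemma sqnorm_gt0_ae (R : realType) n : (0 < n)%N ->
  exists N : set 'rV[R]_n, [/\ measurable N, lebesgueN R n N = 0%E &
    forall x, ~ N x -> 0 < sqnorm x].
Proof.
case: n => // n _; exists [set x | x ord0 ord0 = 0]; split.
- exact: (measurable_rV_coord _ (measurable_set1 (0:R))).
- exact: lebesgueN_coord0.
- move=> x /eqP x0; apply: lt_le_trans (sqr_coord_le_sqnorm x ord0).
  by rewrite exprn_even_gt0.
Qed.

(** * The Gaussian as a trial function *)

Section upper_bound.
Context (R : realType) (n : nat).
Local Notation V := 'rV[R]_n.
Local Notation leb := (lebesgueN R n).

(** The integral of f(x - t e_i) does not depend on t, so its derivative at 0 vanishes; this
    replaces integration by parts and its boundary terms. *)
Lemma Rintegral_partial_eq0 (i : 'I_n) (f f' K : V -> R) :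
  measurable_fun setT f' ->
  (forall x, is_derive x (delta_mx ord0 i : V) f (f' x)) ->
  leb.-integrable setT (EFin \o f) -> leb.-integrable setT (EFin \o K) ->
  (forall t x, `|t| < 1 -> `|f' (x - t *: delta_mx ord0 i)| <= K x) ->
  \int[leb]_x f' x = 0.
Proof.
move=> mf' df fi Ki f'K.
have mf := integrable_measurable fi.
have [] := @is_derive_shift_integral R n i (cst 1) f f' K 0 (measurable_cst _) mf' df.
- move=> t; under eq_fun do rewrite mul1r.
  exact: (@integrable_shift R n (- (t *: delta_mx ord0 i)) (EFin \o f)).
- exact: Ki.
- by move=> t x; rewrite subr0 mul1r; exact: f'K.
move=> _; rewrite (_ : (fun t : R => _) = cst (\int[leb]_x f x)); last first.
  apply/funext => t; under eq_Rintegral do rewrite mul1r.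
  exact: (@Rintegral_shift R n (- (t *: delta_mx ord0 i))).
rewrite derive_cst => /esym/eqP; rewrite oppr_eq0 => /eqP I0.
by rewrite -[RHS]I0; apply: eq_Rintegral => x _; rewrite scale0r subr0 mul1r.
Qed.

Let G c (x : V) := expR (- (c * sqnorm x)).

Let is_derive_G c i x :
  is_derive x (delta_mx ord0 i : V) (G c) (- (2 * c * x ord0 i) * G c x).
Proof.
apply/is_derive_lineP; pose b := x ord0 i; pose q := sqnorm x.
have dp := is_derive_quadratic q b.
have dq : is_derive (0:R) (1:R) (fun t : R => - (c * (q + (2 * b * t + t ^+ 2))))
    (- c * (2 * b)).
  rewrite (_ : (fun t => _) = - c \*: (fun t : R => q + (2 * b * t + t ^+ 2))).
    exact: is_deriveZ.
  by apply/funext => t; exact/esym/mulNr.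
have q0 : - (c * (q + (2 * b * 0 + 0 ^+ 2))) = - (c * q) by ring.
have dE := @is_derive1_comp R expR (fun t : R => - (c * (q + (2 * b * t + t ^+ 2)))) 0 _ _
  (is_derive_expR _) dq.
rewrite (_ : (fun t : R => _) = expR \o (fun t => - (c * (q + (2 * b * t + t ^+ 2))))).
  by apply: is_derive_eq; rewrite q0 /G -/b -/q; ring.
by apply/funext => t; rewrite /G sqnorm_line.
Qed.

Let mG c : measurable_fun setT (G c). Proof. exact: measurable_gaussian. Qed.

Let mx i : measurable_fun setT (fun x : V => x ord0 i).
Proof. exact: measurable_coord. Qed.

Let iG1 : leb.-integrable setT (EFin \o G 1).
Proof. by rewrite /G; under eq_fun do rewrite mul1r; exact: integrable_gaussian. Qed.

Let mulr_expRN_le1 (s : R) : s * expR (- s) <= 1.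
Proof.
rewrite expRN ler_pdivrMr ?expR_gt0// mul1r.
by apply: le_trans (expR_ge1Dx s); rewrite lerDr.
Qed.

Let GD c d x : G (c + d) x = G c x * G d x.
Proof. by rewrite /G mulrDl opprD expRD. Qed.

Let G_le1 c x : 0 <= c -> G c x <= 1.
Proof. by move=> c0; rewrite -expR0 ler_expR oppr_le0 mulr_ge0// sqnorm_ge0. Qed.

Let sG_le1 c x : 1 <= c -> sqnorm x * G c x <= 1.
Proof.
move=> c1; apply: le_trans (mulr_expRN_le1 (sqnorm x)).
by rewrite ler_wpM2l ?sqnorm_ge0// ler_expR lerN2 ler_peMl// sqnorm_ge0.
Qed.

Let G_ge0 c x : 0 <= G c x. Proof. exact: expR_ge0. Qed.

Let u := G 2.
Let g i (x : V) := - (4 * x ord0 i) * u x.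

Let u2E x : u x ^+ 2 = G 4 x.
Proof. by rewrite expr2 -GD; congr (G _ x); ring. Qed.

(** [G 1] is kept as the integrable dominating factor, while [G 3] absorbs polynomial growth. *)
Let G4E x : G 4 x = G 1 x * G 3 x.
Proof. by rewrite -GD; congr (G _ x); ring. Qed.

Let iG4 : leb.-integrable setT (EFin \o G 4).
Proof.
apply: integrable_dominated iG1 => // x; rewrite ger0_norm// G4E.
by rewrite -[leRHS]mulr1 ler_wpM2l// G_le1.
Qed.

Let iG4x i : leb.-integrable setT (EFin \o (fun x : V => x ord0 i ^+ 2 * G 4 x)).
Proof.
apply: integrable_dominated iG1.
  by apply: measurable_funM => //; exact: measurable_funX.
move=> x; rewrite ger0_norm; last by rewrite mulr_ge0 ?sqr_ge0 ?G_ge0.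
rewrite G4E mulrCA -[leRHS]mulr1 ler_wpM2l//.
apply: (@le_trans _ _ (sqnorm x * G 3 x)); last by apply: sG_le1; lra.
by rewrite ler_wpM2r// sqr_coord_le_sqnorm.
Qed.

Let Lu : L2 leb u.
Proof.
split; first exact: mG.
by rewrite (_ : (fun x => u x ^+ 2) = G 4)//; apply/funext => x; exact: u2E.
Qed.

Let mg i : measurable_fun setT (g i).
Proof.
apply: measurable_funM; last exact: mG.
by apply: measurable_funN; exact: measurable_funM.
Qed.

Let g2E i (x : V) : g i x ^+ 2 = 16 * (x ord0 i ^+ 2 * G 4 x).
Proof. by rewrite /g -u2E; ring. Qed.

Let Lg i : L2 leb (g i).
Proof.
split => //; under eq_fun do rewrite g2E; exact: integrableZr.
Qed.

Let g_le4 i (x : V) : `|g i x| <= 4.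
Proof.
rewrite /g normrM normrN normrM (ger0_norm (G_ge0 _ _)) ger0_norm// -mulrA.
rewrite ler_piMr//.
have h1 : `|x ord0 i| ^+ 2 <= sqnorm x by rewrite real_normK ?num_real// sqr_coord_le_sqnorm.
have : expR (2 * sqnorm x) * u x = 1 by rewrite /u /G -expRD subrr expR0.
have := expR_ge1Dx (2 * sqnorm x); have := G_ge0 2 x; rewrite -/u => u0 e1 eu.
have : `|x ord0 i| <= expR (2 * sqnorm x).
  by have := sqr_ge0 (`|x ord0 i| - 1); have := sqnorm_ge0 x; have := normr_ge0 (x ord0 i); nra.
by move=> /(ler_wpM2r u0); rewrite eu.
Qed.

(** The partial derivative of [u] times [phi] has integral zero by [Rintegral_partial_eq0]. *)
Let weak_gradient_G : L2_weak_gradient u g.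
Proof.
move=> i; split; first exact/Lfun_L2.
move=> phi [sphi cphi].
have cp : continuous phi by have [] := sphi [::].
have bp := compact_box_supported cphi.
have dp x : is_derive x (delta_mx ord0 i : V) phi (partial i phi x).
  by have [_ /(_ i x) d] := sphi [::]; exact: DeriveDef.
have cp' : continuous (partial i phi) by have [] := sphi [:: i].
have bp' := box_supported_partial dp bp.
have Lp := box_supported_L2 cp bp; have Lp' := box_supported_L2 cp' bp'.
have iup := L2_mul Lu Lp'; have igp := L2_mul (Lg i) Lp.
have [K [_ iK pK]] := box_supported_shift_bound i 0 cp bp.
have [K' [_ iK' pK']] := box_supported_shift_bound i 0 cp' bp'.
rewrite -!EFin_Rintegral// -EFinN; congr EFin; apply/eqP; rewrite -addr_eq0; apply/eqP.
rewrite -RintegralD//.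
apply: (@Rintegral_partial_eq0 i (fun x => u x * phi x) _
  (fun x => K' x + 4 * K x)).
- by apply: measurable_funD; apply: measurable_funM => //; [exact: mG|case: Lp'|case: Lp].
- move=> x; rewrite (_ : (fun x => _) = u * phi)//.
  apply: is_derive_eq; first exact: (is_deriveM (is_derive_G 2 i x) (dp x)).
  rewrite /GRing.scale/= /g /u; ring.
- exact: L2_mul.
- by apply: integrableDr => //; exact: integrableZr.
- move=> t x t1; apply: le_trans (ler_normD _ _) _; rewrite normrM [X in _ + X]normrM.
  have t1' : `|t - 0| < 1 by rewrite subr0.
  apply: lerD.
    apply: le_trans (pK' _ _ t1'); rewrite ler_piMl// ger0_norm; last exact: G_ge0.
    exact: G_le1.
  exact: (ler_pM (normr_ge0 _) (normr_ge0 _) (g_le4 _ _) (pK _ _ t1')).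
Qed.

(** The derivative of x_i [G 4] in direction e_i is (1 - 8 x_i^2) [G 4], whose integral vanishes:
    each coordinate has variance 1 / 8 under the density proportional to [u]^2. *)
Let moment i : \int[leb]_x (x ord0 i ^+ 2 * G 4 x) = 8^-1 * nsq leb u.
Proof.
have E : \int[leb]_x (G 4 x - 8 * (x ord0 i ^+ 2 * G 4 x)) = 0.
  apply: (@Rintegral_partial_eq0 i (fun x => x ord0 i * G 4 x) _
    (fun x => 4 * expR 2 * G 1 x)).
  - apply: measurable_funB => //; apply: measurable_funM => //.
    by apply: measurable_funM => //; exact: measurable_funX.
  - move=> x; have dx : is_derive x (delta_mx ord0 i : V) (fun y : V => y ord0 i) 1.
      apply/is_derive_lineP.
      rewrite (_ : (fun t : R => _) = @id R + cst (x ord0 i)).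
        by apply: is_derive_eq; rewrite addr0.
      by apply/funext => t; rewrite !mxE !eqxx mulr1.
    rewrite (_ : (fun x => _) = (fun y : V => y ord0 i) * G 4)//.
    apply: is_derive_eq; first exact: (is_deriveM dx (is_derive_G 4 i x)).
    by rewrite /GRing.scale/=; ring.
  - apply: integrable_dominated iG1; first exact: measurable_funM.
    move=> x; rewrite normrM (ger0_norm (G_ge0 _ _)) G4E mulrCA -[leRHS]mulr1 ler_wpM2l//.
    have h1 : `|x ord0 i| ^+ 2 <= sqnorm x by rewrite real_normK ?num_real// sqr_coord_le_sqnorm.
    have : expR (3 * sqnorm x) * G 3 x = 1 by rewrite /G -expRD subrr expR0.
    have := expR_ge1Dx (3 * sqnorm x); have := G_ge0 3 x => u0 e1 eu.
    have : `|x ord0 i| <= expR (3 * sqnorm x).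
      by have := sqr_ge0 (`|x ord0 i| - 1); have := sqnorm_ge0 x; have := normr_ge0 (x ord0 i); nra.
    by move=> /(ler_wpM2r u0); rewrite eu.
  - exact: integrableZr.
  - move=> t x t1; set y := x - t *: delta_mx ord0 i.
    (* Domination uniform in the shift: of the two factors in [G 4 y = G 2 y * G 2 y], one is
       compared with [G 1 x] through this inequality, at the cost of [expR 2], and the other absorbs
       1 + 8 |y|^2, at the cost of 4. *)
    have yx : sqnorm x <= 2 * sqnorm y + 2.
      have -> : x = t *: delta_mx ord0 i + y by rewrite /y addrC subrK.
      rewrite sqnorm_line; have := sqr_coord_le_sqnorm y i.
      have : t ^+ 2 <= 1 by rewrite -real_normK ?num_real// expr_le1// ltW.
      have := sqr_ge0 (y ord0 i - t); lra.
    have G1 : G 2 y <= expR 2 * G 1 x.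
      by rewrite /G -expRD ler_expR; lra.
    have G2 : (1 + 8 * sqnorm y) * G 2 y <= 4.
      have : (1 + 2 * sqnorm y) * G 2 y <= 1.
        rewrite /G expRN ler_pdivrMr ?expR_gt0// mul1r; exact: expR_ge1Dx.
      have := G_ge0 2 y; lra.
    have E4 : G 4 y = G 2 y * G 2 y by rewrite -GD; congr (G _ y); ring.
    have p0 : 0 <= G 4 y by [].
    have c0 := sqr_coord_le_sqnorm y i; have d0 := sqr_ge0 (y ord0 i).
    apply: (@le_trans _ _ ((1 + 8 * sqnorm y) * G 4 y)).
      have := ler_wpM2r p0 c0; have := mulr_ge0 d0 p0.
      by move=> H1 H2; rewrite ler_norml; apply/andP; split; lra.
    rewrite E4 mulrA -[leRHS]mulrA; apply: ler_pM => //.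
    by rewrite mulr_ge0//; have := sqnorm_ge0 y; lra.
have iz := integrableZr 8 (iG4x i).
rewrite RintegralB// RintegralZl// in E.
have -> : nsq leb u = \int[leb]_x G 4 x by apply: eq_Rintegral => x _; rewrite u2E.
lra.
Qed.

Lemma best_constant_le (nu : R) : (2 < n)%N ->
  (best_constant n nu <= ((2 * n%:R + 1) * (nu ^+ 2 + n%:R / 8))%:E)%E.
Proof.
(* By [moment], [c] is the mean of nu^2 + |x|^2 under the density proportional to [u]^2. *)
move=> n2; set c := nu ^+ 2 + n%:R / 8.
have n0 : 0 < n%:R :> R by rewrite ltr0n; case: (n) n2.
have c0 : 0 < c by rewrite ltr_wpDl ?sqr_ge0// divr_gt0.
have u0 : ~ u = \0 %[ae leb].
  move=> [N [mN N0 sub]]; have := lebesgueN_setT_gt0 R n.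
  rewrite (_ : [set: V] = N) ?N0 ?ltxx//; apply/esym/seteqP; split => // x _.
  by apply: sub => /= /(_ I) /eqP; rewrite gt_eqF// /u /G expR_gt0.
have U0 := nsq_gt0 Lu u0.
apply: ge_ereal_inf; exists (H1_energy u g / weighted_L2 nu u)%E.
  exists u, g; split; [|exact: u0|exact: weak_gradient_G|by []].
  by split; [exact/Lfun_L2|exists g; exact: weak_gradient_G].
(* Each direction contributes 16 / 8 = 2 times [nsq leb u], by [g2E] and [moment]. *)
have -> : H1_energy u g = ((2 * n%:R + 1) * nsq leb u)%:E.
  rewrite H1_energyE//; congr EFin.
  rewrite (eq_bigr (fun=> 2 * nsq leb u)); first by rewrite sumr_const card_ord -mulr_natl; ring.
  move=> i _; rewrite /nsq; under eq_Rintegral do rewrite g2E.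
  by rewrite RintegralZl// moment /nsq; field.
pose w (x : V) := u x ^+ 2 / (nu ^+ 2 + sqnorm x).
have w0 x : 0 <= w x.
  by rewrite divr_ge0 ?sqr_ge0// addr_ge0 ?sqr_ge0 ?sqnorm_ge0.
have iw : leb.-integrable setT (EFin \o w).
  apply/integrableP; split.
    apply/measurable_EFinP; apply: measurable_funM.
      by apply: measurable_funX; exact: mG.
    apply: measurable_inv_ge0 => [x|]; first by rewrite addr_ge0 ?sqr_ge0 ?sqnorm_ge0.
    by apply: measurable_funD => //; exact: measurable_sqnorm.
  rewrite (eq_integral (fun x => (w x)%:E)); last by move=> x _; rewrite /= ger0_norm.
  (* For [nu = 0] the integrand is unbounded near the origin; Hardy's inequality applied to the
     Gaussian supplies the integrability. *)
  by apply: le_lt_trans (hardy nu n2 Lu weak_gradient_G) _; rewrite ltry.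
have -> : weighted_L2 nu u = (\int[leb]_x w x)%:E by rewrite EFin_Rintegral.
(* Jensen: bound [1 / s] below by its tangent line at [s = c]. *)
have wU : nsq leb u / c <= \int[leb]_x w x.
  pose h (x : V) := 2 / c * u x ^+ 2 - (nu ^+ 2 / c ^+ 2 * u x ^+ 2 +
    c ^- 2 * \sum_(i < n) x ord0 i ^+ 2 * G 4 x).
  have [mu_ iu] := Lu.
  have ih : leb.-integrable setT (EFin \o h).
    apply: integrableBr; first exact: integrableZr.
    apply: integrableDr; first exact: integrableZr.
    by apply: integrableZr; exact: integrable_sumr.
  have hE : \int[leb]_x h x = nsq leb u / c.
    rewrite RintegralB//; last 2 first.
    - exact: integrableZr.
    - by apply: integrableDr; apply: integrableZr => //; exact: integrable_sumr.
    rewrite RintegralD//; last 2 first.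
    - exact: integrableZr.
    - by apply: integrableZr; exact: integrable_sumr.
    rewrite !RintegralZl//; last exact: integrable_sumr.
    rewrite Rintegral_sum// (eq_bigr (fun=> 8^-1 * nsq leb u)); last by move=> i _; exact: moment.
    rewrite sumr_const card_ord -/(nsq leb u) -[_ *+ n]mulr_natl.
    have E : nu ^+ 2 = c - n%:R / 8 by rewrite /c addrK.
    by rewrite E; field; rewrite gt_eqF.
  rewrite -hE -subr_ge0 -RintegralB//.
  have iwh := integrableBr iw ih.
  have [N [mN N0 sN]] := sqnorm_gt0_ae R (ltnW (ltnW n2)).
  rewrite /Rintegral (negligible_integral mN measurableT iwh N0).
  apply: fine_ge0; apply: integral_ge0 => x [_ /sN sx]; rewrite lee_fin.
  have s0 : 0 < nu ^+ 2 + sqnorm x by rewrite ltr_wpDl ?sqr_ge0.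
  rewrite /w /h u2E -mulr_suml -/(sqnorm x); set q := sqnorm x in s0 *.
  have -> : G 4 x / (nu ^+ 2 + q) - (2 / c * G 4 x - (nu ^+ 2 / c ^+ 2 * G 4 x +
      c ^- 2 * (q * G 4 x))) = G 4 x * ((nu ^+ 2 + q - c) / c) ^+ 2 / (nu ^+ 2 + q).
    by field; rewrite !gt_eqF.
  by rewrite divr_ge0 ?(ltW s0)// mulr_ge0// sqr_ge0.
rewrite inver ifF; last first.
  by apply/negbTE; rewrite gt_eqF// (lt_le_trans _ wU)// divr_gt0.
rewrite -EFinM lee_fin -mulrA; apply: ler_wpM2l; first by rewrite addr_ge0// mulr_ge0.
rewrite ler_pdivrMr; last by rewrite (lt_le_trans _ wU)// divr_gt0.
by move: wU; rewrite ler_pdivrMr// mulrC.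
Qed.

End upper_bound.

(** * The limit by squeezing *)

Theorem theorem1p3 (R : realType) (nu : R) :
  (best_constant N nu /
    (N%:R ^+ 2 * (N%:R - 2) / (4 * (N%:R + 1)))%:E)%E @[N --> \oo] --> 1%:E.
Proof.
pose D (N : nat) : R := N%:R ^+ 2 * (N%:R - 2) / (4 * (N%:R + 1)).
pose h (N : nat) : R := N%:R^-1.
have h0 : h N @[N --> \oo] --> (0 : R).
  by rewrite -cvg_shiftS; exact: cvg_harmonic.
have cvg_lin (c d : R) : c + d * h N @[N --> \oo] --> c.
  rewrite -[X in _ --> X]addr0 -[X in _ + X](mulr0 d).
  by apply: cvgD; [exact: cvg_cst|apply: cvgM => //; exact: cvg_cst].
have n0 N : (2 < N)%N -> 0 < N%:R :> R by case: N => // N _; rewrite ltr0Sn.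
have n2 N : (2 < N)%N -> 0 < N%:R - 2 :> R by move=> N2; rewrite subr_gt0 ltr_nat.
have D0 N : (2 < N)%N -> 0 < D N.
  move=> N2; have := n0 _ N2; have := n2 _ N2 => NN2 NN.
  by apply: divr_gt0; apply: mulr_gt0 => //; exact: exprn_gt0.
(* Both bounds divided by [D N] are, for [N > 2], rational functions of 1 / N, with value 1 at 1 / N
   = 0. *)
pose lo N := ((1 + (- 2) * h N) * (1 + 1 * h N))%:E.
pose hi N := ((2 + 1 * h N) * (1 + 8 * nu ^+ 2 * h N) * (1 + 1 * h N) /
  (2 + (- 4) * h N))%:E.
have lo_cvg : lo N @[N --> \oo] --> 1%:E.
  apply: cvg_EFin; first exact: nearW.
  rewrite -[X in _ --> X](mulr1 1); apply: cvgM; exact: cvg_lin.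
have hi_cvg : hi N @[N --> \oo] --> 1%:E.
  apply: cvg_EFin; first exact: nearW.
  rewrite -[X in _ --> X](_ : 2 * 1 * 1 / 2 = 1); last by field.
  apply: cvgM; last by apply: cvgV => //; exact: cvg_lin.
  by do 2 (apply: cvgM; last exact: cvg_lin); exact: cvg_lin.
apply: squeeze_cvge lo_cvg hi_cvg; near=> N.
have N2 : (2 < N)%N by near: N; exact: nbhs_infty_gt.
have := D0 _ N2; rewrite -/(D N) => DN; have NN := n0 _ N2; have NN2 := n2 _ N2.
have DV : 0 <= (D N)^-1 by rewrite invr_ge0 ltW.
rewrite inver gt_eqF//.
have NN1 : 0 < N%:R + 1 :> R by [].
have loE : lo N = (((N%:R - 2) ^+ 2 / 4)%:E * (D N)^-1%:E)%E.
  rewrite -EFinM /lo /D /h; congr EFin; field.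
  by rewrite !gt_eqF.
have hiE : hi N = (((2 * N%:R + 1) * (nu ^+ 2 + N%:R / 8))%:E * (D N)^-1%:E)%E.
  rewrite -EFinM /hi /D /h; congr EFin; field.
  by rewrite !gt_eqF//; lra.
rewrite loE hiE; apply/andP; split; apply: lee_wpmul2r; rewrite ?lee_fin//.
  exact: best_constant_ge.
exact: best_constant_le.
Unshelve. all: by end_near. Qed.
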